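(* Let $q>1$, and let $(V,E,\mu)$ be a weighted graph with vertex weight $\sigma$ and a $\nu$-adapted edge-length function $\rho$ whose path metric $d_\rho$ is proper (as in the context). Assume that, for some (and hence every) $o\in V$, $$\int_1^\infty\frac{r}{M_o(r)^{q-1}}\,dr=\infty.$$ Then every nonnegative global classical supersolution of $$\partial_tu-\Delta_\sigma u\ge u^q\qquad\text{on }(0,\infty)\times V$$ vanishes identically.
   Context: Let $(V,E)$ be an infinite, connected, locally finite graph with at most one edge between two distinct vertices and no loops. Let $\mu:V\times V\to[0,\infty)$ be symmetric with $\mu_{xy}>0$ if $x\sim y$ and $\mu_{xy}=0$ otherwise; put $\mu(x)=\sum_{y\sim x}\mu_{xy}$. Fix $\sigma:V\to(0,\infty)$ and set $\nu(x)=\sigma(x)\mu(x)$, $\nu(A)=\sum_{x\in A}\nu(x)$. The operator is $$\Delta_\sigma f(x)=\frac1{\nu(x)}\sum_{y\sim x}\mu_{xy}(f(y)-f(x)).$$ A positive symmetric edge-length function $\rho:E\to(0,\infty)$ is $\nu$-adapted if $\sum_{y\sim x}\mu_{xy}\rho(x,y)^2\le\nu(x)$ for all $x\in V$. Its path metric is $d_\rho(x,y)=\inf\sum_{i=1}^n\rho(x_{i-1},x_i)$, the infimum over paths $x=x_0\sim x_1\sim\dots\sim x_n=y$. Properness of $d_\rho$ means that every ball $B_\rho(o,r)=\{x\in V:d_\rho(o,x)\le r\}$ is finite. Put $M_o(r)=\nu(B_\rho(o,r))$. A nonnegative global classical supersolution of $\partial_tu-\Delta_\sigma u\ge u^q$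 on $(0,\infty)\times V$ is a function $u:(0,\infty)\times V\to[0,\infty)$ with $u(\cdot,x)\in C^1((0,\infty))$ for every $x\in V$ satisfying the inequality pointwise; no value or trace at $t=0$ is assumed. *)

(* Defs.v *)
From HB Require Import structures.
From mathcomp Require Export all_boot all_order all_algebra.
From mathcomp Require Export all_classical all_reals all_analysis.
Export Order.TTheory GRing.Theory Num.Theory.
Export numFieldNormedType.Exports.

Set Implicit Arguments.
Unset Strict Implicit.
Unset Printing Implicit Defensive.

Local Open Scope classical_set_scope.
Local Open Scope ring_scope.

Section WeightedGraph.
Context {R : realType} {V : choiceType}.
Implicit Types (e : rel V) (mu rho : V -> V -> R) (sigma : V -> R).

Definition neighbors e (x : V) : set V := [set y | e x y].

Definition locally_finite_graph e : Prop :=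
  forall x, finite_set (neighbors e x).

Definition connected_graph e : Prop :=
  forall x y, exists2 p : seq V, path e x p & last x p = y.

Definition edge_weight e mu : Prop :=
  [/\ forall x y, mu x y = mu y x,
      forall x y, e x y -> 0 < mu x y
    & forall x y, ~~ e x y -> mu x y = 0].

Definition vertex_mu e mu (x : V) : R := \sum_(y \in neighbors e x) mu x y.

Definition vertex_nu e mu sigma (x : V) : R := sigma x * vertex_mu e mu x.

(* Only meaningful for a finite set A: fsbigop returns 0 on an infinite
   support. It is used below on balls of a proper metric. *)
Definition nu_measure e mu sigma (A : set V) : R :=
  \sum_(x \in A) vertex_nu e mu sigma x.

Definition laplacian e mu sigma (f : V -> R) (x : V) : R :=
  (vertex_nu e mu sigma x)^-1 * \sum_(y \in neighbors e x) mu x y * (f y - f x).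

(* rho is a function on the edge set: its values at non-adjacent pairs are
   unconstrained and never used. *)
Definition edge_length e rho : Prop :=
  (forall x y, e x y -> 0 < rho x y) /\ (forall x y, e x y -> rho x y = rho y x).

Definition adapted e mu sigma rho : Prop :=
  forall x, \sum_(y \in neighbors e x) mu x y * rho x y ^+ 2
            <= vertex_nu e mu sigma x.

Fixpoint path_length rho (x : V) (p : seq V) : R :=
  if p is y :: p' then rho x y + path_length rho y p' else 0.

(* The empty path is allowed, so that the distance from x to x is 0. *)
Definition path_dist e rho (x y : V) : R :=
  inf [set l | exists p : seq V,
         [/\ path e x p, last x p = y & l = path_length rho x p]].

Definition dist_ball e rho (o : V) (r : R) : set V :=
  [set x | path_dist e rho o x <= r].

Definition proper_dist e rho : Prop :=
  forall o r, finite_set (dist_ball e rho o r).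

Definition ball_volume e mu sigma rho (o : V) (r : R) : R :=
  nu_measure e mu sigma (dist_ball e rho o r).

Definition volume_integral_diverges e mu sigma rho (q : R) (o : V) : Prop :=
  (\int[lebesgue_measure]_(r in `[1%R, +oo[)
     (r / ball_volume e mu sigma rho o r `^ (q - 1))%:E = +oo)%E.

(* Functions on (0, oo) are represented by functions on R whose values at
   t <= 0 are irrelevant; since (0, oo) is open, the derivative at t > 0
   depends only on the values on (0, oo). *)
Definition C1_pos (f : R -> R) : Prop :=
  (forall t, 0 < t -> derivable f t 1) /\
  (forall t, 0 < t -> {for t, continuous (derive1 f)}).

Definition classical_supersolution e mu sigma (q : R) (u : R -> V -> R) : Prop :=
  [/\ forall t x, 0 < t -> 0 <= u t x,
      forall x, C1_pos (u ^~ x)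
    & forall t x, 0 < t ->
        derive1 (u ^~ x) t - laplacian e mu sigma (u t) x >= u t x `^ q].

End WeightedGraph.

(* Main.v *)
From mathcomp Require Import finmap ring lra measurable_realfun.
Require Import Defs.

(** Fix a centre o, let d be the distance to o and M(r) the volume of the ball
of radius r, and for r = 2^j, T = 4^j consider the parabolic cutoff
    phi_j(t, x) = max(0, 1 - t / 4^j) max(0, 1 - d(x) / 2^j).
For a supersolution u and a small starting time tau > 0 put
    X_j = int_tau^(4^j) sum_x nu(x) u^q phi_j^(2m+2) dt,
    D_j = int_tau^(4^j) sum_x nu(x) u^q phi_j^(2m+2) (t / 4^j)^gamma dt,
with a large m and a small gamma > 0 depending on q only. The heart of the
matter is the estimate at a single scale
    g_j X_j^q <= C D_j,   where g_j = 4^j M(2^j)^(1 - q),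
which is [scale_estimate]. The weights (t / 4^j)^gamma are summable over the
scales 4^j > t, so S_n = D_0 + ... + D_n satisfies S_n <= C X_n. Hence
    g_n S_n^q <= C (S_n - S_(n-1)),
a discrete form of g <= - C (S^(1-q))'. As soon as S is positive somewhere, the
right-hand side telescopes and the series of the g_n converges
([telescoping_bound]). Cutting [1, oo) into dyadic shells shows that this
series is comparable with the integral of r / M(r)^(q-1); its divergence
therefore forces u = 0. The same comparison, with balls of two centres nested
into each other, gives the independence of the centre.

The single-scale estimate has to live with the fact that an adapted metric
controls only the gradient of d and not its Laplacian, so that testing the
inequality with a power of phi alone is of no use. The test function is instead
    h(u / A) phi^(2m+2),   h(z) = 1 + (1 + z)^(1/q - 1),
with a free amplitude A > 0. As h is decreasing, the term in which it is
differentiated has a good sign and absorbs the cross term with the gradient of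
phi; this can be done edge by edge ([caccioppoli_edge]). The remaining error
sits at the end point of the edge where phi is larger, so it never sees the
values of u outside the ball, and edges may be arbitrarily long. After
summation, adaptedness turns it into
    (C / 4^j) sum_x nu(x) (1 + u / A)^(2 - 1/q) phi^(2m).
Because of the long edges this error is spread over the whole ball, and not only
over an annulus near its boundary. Since 2 - 1/q < q, Young's inequality bounds
it by (u / A)^q phi^(2m+2) (t / 4^j)^gamma, which is where D_j comes from, plus
a multiple of (4^j / t)^(1/2), which is integrable in time
([weighted_young]). The result is
    X_j <= C (A^(1-q) D_j / 4^j + A M(2^j))   for every A > 0
([amplitude_estimate]), and an A proportional to X_j / M(2^j) gives the
estimate. The boundary term at the starting time has a favourable sign, so no
information on u near t = 0 enters. *)

Set Implicit Arguments.
Unset Strict Implicit.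
Unset Printing Implicit Defensive.

Local Open Scope classical_set_scope.
Local Open Scope ring_scope.

(** * Edgewise inequality for a damped test function *)

Section Scalar.
Context {R : realType}.
Implicit Types (q s t z c p r : R).

(** The exponent 1/q - 1 meets two demands: it is larger than -1, so that the
primitive grows at most linearly, and the slope of the damping decays like the
power 1/q - 2, where 2 - 1/q stays below q. *)
Definition damping q z : R := 1 + (1 + z) `^ (q^-1 - 1).

Definition damping_primitive q z : R := z + q * (1 + z) `^ q^-1.

(** This is the tangent inequality at t for the convex function s^(-a), read off
from [expR x >= 1 + x] and [ln y >= 1 - 1/y] with y = t/s. *)
Lemma powR_lower_slope (a s t : R) : 0 <= a -> 0 < s -> 0 < t -> s <= t ->
  a * (t - s) * t `^ (- a - 1) <= s `^ (- a) - t `^ (- a).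
Proof.
move=> a0 s0 t0 st.
have t_neq0 : t != 0 by rewrite gt_eqF.
have -> : s `^ (- a) = t `^ (- a) * expR (a * ln (t / s)).
  rewrite /powR !gt_eqF// -expRD lnM ?posrE ?invr_gt0// lnV ?posrE//.
  by congr expR; ring.
rewrite powRD ?t_neq0 ?implybT// powR_inv1 ?(ltW t0)//.
have lnts : (t - s) / t <= ln (t / s).
  have /le_ln1Dx : -1 < s / t - 1 by rewrite ltrBrDr addNr divr_gt0.
  rewrite addrCA subrr addr0 -[t / s]invf_div lnV ?posrE ?divr_gt0// => H.
  by rewrite mulrBl divff// -opprB lerN2.
have /(ler_wpM2l a0) := lnts.
have := expR_ge1Dx (a * ln (t / s)).
have := powR_gt0 (- a) t0.
set P := t `^ _; set E := expR _; set L := a * ln _ => P0 HE HL.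
have -> : a * (t - s) * (P / t) = P * (a * ((t - s) / t)) by ring.
have -> : P * E - P = P * (E - 1) by ring.
rewrite ler_wpM2l ?(ltW P0)//.
by lra.
Qed.

Lemma damping_bounds q z : 1 < q -> 0 <= z ->
  1 <= damping q z <= 2.
Proof.
move=> q1 z0; rewrite /damping lerDl powR_ge0/= -[leRHS]/(1 + 1) lerD2l.
rewrite -[leRHS](powRr0 (1 + z)) ler_powR ?lerDl//.
by rewrite subr_le0 invf_le1 ?(ltW q1)// (lt_trans _ q1).
Qed.

Lemma damping_drop q s t : 1 < q -> 0 <= s -> s <= t ->
  (1 - q^-1) * (1 + t) `^ (q^-1 - 2) * (t - s) <= damping q s - damping q t.
Proof.
move=> q1 s0 st.
have q0 : 0 < q := lt_trans ltr01 q1.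
have a0 : 0 <= 1 - q^-1 by rewrite subr_ge0 invf_le1// ltW.
have := @powR_lower_slope (1 - q^-1) (1 + s) (1 + t) a0.
have -> : - (1 - q^-1) = q^-1 - 1 by ring.
have -> : q^-1 - 1 - 1 = q^-1 - 2 by ring.
have -> : (1 + t) - (1 + s) = t - s by ring.
move=> /(_ _ _ _)/le_trans H.
rewrite /damping [leRHS](_ : _ = (1 + s) `^ (q^-1 - 1) - (1 + t) `^ (q^-1 - 1)).
  by rewrite mulrAC; apply: H => //; lra.
by ring.
Qed.

(** Expanding r = p + (r - p), the drop of h contributes
c (t - s)^2 p^2, which by completing a square absorbs the cross term
2 ht (t - s) p (r - p). *)
Lemma caccioppoli_edge_increasing c hs ht s t p r :
  0 < c -> 0 <= s -> s <= t -> 0 <= p -> p <= r -> 0 <= ht <= 2 ->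
  c * (t - s) <= hs - ht ->
  - ((r - p) ^+ 2 * (2 * t + 4 / c)) <= (t - s) * (hs * p ^+ 2 - ht * r ^+ 2).
Proof.
move=> c0 s0 st p0 pr /andP[ht0 ht2] drop.
set d := t - s; set e := r - p.
have d0 : 0 <= d by rewrite subr_ge0.
have e0 : 0 <= e by rewrite subr_ge0.
have -> : hs * p ^+ 2 - ht * r ^+ 2 =
   (hs - ht) * p ^+ 2 - 2 * ht * p * e - ht * e ^+ 2 by rewrite /e; ring.
have H1 : d * (c * d * p ^+ 2) <= d * ((hs - ht) * p ^+ 2).
  by rewrite ler_wpM2l// ler_wpM2r// sqr_ge0.
have H2 : d * (2 * ht * p * e) <= d * (4 * p * e).
  by rewrite ler_wpM2l// !ler_wpM2r//; lra.
have H3 : d * (ht * e ^+ 2) <= t * (2 * e ^+ 2).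
  apply: ler_pM => //; first by rewrite mulr_ge0// sqr_ge0.
    by rewrite /d; lra.
  by rewrite ler_wpM2r// sqr_ge0.
have H4 : 0 <= c^-1 * (c * d * p - 2 * e) ^+ 2.
  by rewrite mulr_ge0 ?sqr_ge0// invr_ge0 ltW.
have H5 : c^-1 * (c * d * p - 2 * e) ^+ 2 =
    d * (c * d * p ^+ 2) - d * (4 * p * e) + e ^+ 2 * (4 / c).
  by field; rewrite gt_eqF.
rewrite H5 in H4.
have -> : d * ((hs - ht) * p ^+ 2 - 2 * ht * p * e - ht * e ^+ 2) =
    d * ((hs - ht) * p ^+ 2) - d * (2 * ht * p * e) - d * (ht * e ^+ 2) by ring.
have -> : e ^+ 2 * (2 * t + 4 / c) = t * (2 * e ^+ 2) + e ^+ 2 * (4 / c) by ring.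
lra.
Qed.

(** Here p and r are the cutoffs, s and t the values of the solution at the two
ends of an edge. The error involves t only, the value at the end with the larger
cutoff: the error is needed only if t is also the larger value, since otherwise
both factors on the right are nonpositive. *)
Lemma caccioppoli_edge q s t p r : 1 < q -> 0 <= s -> 0 <= t -> 0 <= p ->
  p <= r ->
  - ((r - p) ^+ 2 * ((2 + 4 / (1 - q^-1)) * (1 + t) `^ (2 - q^-1))) <=
    (t - s) * (damping q s * p ^+ 2 - damping q t * r ^+ 2).
Proof.
move=> q1 s0 t0 p0 pr.
have q0 : 0 < q := lt_trans ltr01 q1.
have a0 : 0 < 1 - q^-1 by rewrite subr_gt0 invf_lt1.
have qi0 : 0 < q^-1 by rewrite invr_gt0.
have := damping_bounds q1 s0; have := damping_bounds q1 t0.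
have [st|ts] := leP s t.
  move=> /andP[ht1 ht2] _.
  pose c := (1 - q^-1) * (1 + t) `^ (q^-1 - 2).
  have c0 : 0 < c by rewrite mulr_gt0// powR_gt0; lra.
  apply: le_trans (caccioppoli_edge_increasing c0 s0 st p0 pr _ (damping_drop q1 s0 st)).
    rewrite lerN2 ler_wpM2l ?sqr_ge0// [leRHS]mulrDl lerD//.
      rewrite ler_wpM2l// (@le_trans _ _ (1 + t)) ?lerDr//.
      by rewrite -[leLHS]powRr1 ?addr_ge0// ler_powR ?lerDl//; lra.
    rewrite /c invfM -powRN opprB mulrA.
    by rewrite lexx.
  by rewrite ht2 andbT; lra.
move=> /andP[ht1 ht2] /andP[hs1 hs2].
apply: (@le_trans _ _ 0).
  by rewrite oppr_le0 mulr_ge0 ?sqr_ge0// mulr_ge0 ?powR_ge0// addr_ge0// divr_ge0// ltW.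
rewrite mulr_le0// ?subr_le0 ?(ltW ts)//.
apply: ler_pM => //; try lra; try by rewrite sqr_ge0.
  have a20 : 0 < (1 - q^-1) * (1 + s) `^ (q^-1 - 2) by rewrite mulr_gt0// powR_gt0; lra.
  have := damping_drop q1 t0 (ltW ts).
  have : 0 <= (1 - q^-1) * (1 + s) `^ (q^-1 - 2) * (s - t).
    by rewrite mulr_ge0 ?(ltW a20)// subr_ge0 ltW.
  by lra.
by rewrite ler_sqr ?nnegrE// (le_trans p0).
Qed.

End Scalar.

(** * Weighted Young inequality *)

Section Young.
Context {R : realType}.
Implicit Types (q b w y z s phi : R).

(** The two terms on the right correspond to the cases
y^(q-b) phi^2 w >= 1 and < 1. The second one leaves phi to a nonnegative power
because m is at least b / (q - b). *)
Lemma powR_absorb q b w y phi (m : nat) : 0 < b -> b < q -> 1 <= y ->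
  0 <= phi <= 1 -> 0 < w -> b / (q - b) <= m%:R ->
  y `^ b * phi ^+ (2 * m) <=
    y `^ q * phi ^+ (2 * m.+1) * w + w `^ (- (b / (q - b))).
Proof.
move=> b0 bq y1 /andP[phi0 phi1] w0 hm.
have y0 : 0 < y by apply: lt_le_trans y1.
have qb0 : 0 < q - b by rewrite subr_gt0.
have beta0 : 0 < b / (q - b) by rewrite divr_gt0.
have m0 : (0 < m)%N by rewrite -(ltr0n R); apply: lt_le_trans hm.
have [->|phin0] := eqVneq phi 0.
  by rewrite !expr0n !muln_eq0 /= eqn0Ngt m0/= !(mulr0,mul0r) add0r powR_ge0.
have {phin0}phi0' : 0 < phi by rewrite lt_neqAle eq_sym phin0.
have [large|small] := leP 1 (y `^ (q - b) * phi ^+ 2 * w).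
  apply: (@le_trans _ _ (y `^ b * phi ^+ (2 * m) * (y `^ (q - b) * phi ^+ 2 * w))).
    by rewrite ler_peMr// mulr_ge0 ?powR_ge0 ?exprn_ge0.
  rewrite (_ : y `^ q = y `^ b * y `^ (q - b)); last first.
    by rewrite -powRD ?(gt_eqF y0) ?implybT// addrC subrK.
  rewrite mulnS exprD (_ : _ * _ = y `^ b * y `^ (q - b) *
      (phi ^+ 2 * phi ^+ (2 * m)) * w); last by ring.
  by rewrite lerDl powR_ge0.
apply: (@le_trans _ _ (w `^ (- (b / (q - b))))); last first.
  by rewrite lerDr !mulr_ge0 ?powR_ge0 ?exprn_ge0// ltW.
rewrite powRN -[leRHS]mul1r ler_pdivlMr ?powR_gt0//.
have phim : phi ^+ (2 * m) <= (phi ^+ 2) `^ (b / (q - b)).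
  rewrite exprM -powR_mulrn ?sqr_ge0//; apply: ger_powR => //.
  by rewrite exprn_gt0//= exprn_ile1.
apply: (@le_trans _ _ ((y `^ (q - b) * phi ^+ 2 * w) `^ (b / (q - b)))).
  rewrite powRM ?mulr_ge0 ?powR_ge0 ?sqr_ge0 ?(ltW w0)// powRM ?mulr_ge0 ?powR_ge0 ?sqr_ge0 ?(ltW w0)//.
  rewrite -powRrM (mulrCA (q - b)) divff ?gt_eqF// mulr1.
  by rewrite ler_wpM2r ?powR_ge0// ler_wpM2l ?powR_ge0.
rewrite (_ : 1 = 1 `^ (b / (q - b))); last by rewrite powR1.
by rewrite ge0_ler_powR ?nnegrE ?ler01 ?(ltW small)// ?(ltW beta0)// !mulr_ge0 ?powR_ge0// ?sqr_ge0 ?ltW.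
Qed.

Lemma powR_1D_le q z : 0 <= q -> 0 <= z ->
  (1 + z) `^ q <= 2 `^ q * (1 + z `^ q).
Proof.
move=> q0 z0; have [z1|z1] := leP z 1.
  apply: (@le_trans _ _ (2 `^ q)); first by rewrite ge0_ler_powR ?nnegrE//; lra.
  by rewrite ler_peMr ?powR_ge0// lerDl powR_ge0.
apply: (@le_trans _ _ ((2 * z) `^ q)).
  by rewrite ge0_ler_powR ?nnegrE//; lra.
by rewrite powRM// ler_wpM2l ?powR_ge0// lerDr.
Qed.

(** Half of the reciprocal of [young_exponent], so that the weight
s^(time_exponent) costs exactly s^(-1/2) in Young's inequality, which is
integrable at s = 0. *)
Definition time_exponent q : R := (q - (2 - q^-1)) / (2 * (2 - q^-1)).

Definition young_exponent q : R := (2 - q^-1) / (q - (2 - q^-1)).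

Lemma growth_exponent_bounds q : 1 < q -> 0 < 2 - q^-1 /\ 2 - q^-1 < q.
Proof.
move=> q1; have q0 : 0 < q by apply: lt_trans q1.
have qi1 : q^-1 < 1 by rewrite invf_lt1.
split; first lra.
rewrite -subr_gt0 (_ : _ - _ = (q - 1) ^+ 2 / q); last by field; rewrite gt_eqF.
by rewrite divr_gt0// exprn_gt0// subr_gt0.
Qed.

Lemma time_exponent_gt0 q : 1 < q -> 0 < time_exponent q.
Proof.
move=> /growth_exponent_bounds[b0 bq].
by rewrite divr_gt0 ?subr_gt0 ?mulr_gt0.
Qed.

Lemma weighted_young q z s phi (m : nat) : 1 < q -> 0 <= z -> 0 < s <= 1 ->
  0 <= phi <= 1 -> young_exponent q <= m%:R ->
  (1 + z) `^ (2 - q^-1) * phi ^+ (2 * m) <=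
   2 `^ q * (z `^ q * phi ^+ (2 * m.+1) * s `^ time_exponent q)
   + (2 `^ q + 1) * (Num.sqrt s)^-1.
Proof.
move=> q1 z0 /andP[s0 s1] /andP[phi0 phi1] hm.
have [b0 bq] := growth_exponent_bounds q1.
have q0 : 0 < q by apply: lt_trans q1.
have w0 : 0 < s `^ time_exponent q by rewrite powR_gt0.
have w1 : s `^ time_exponent q <= 1.
  rewrite -[leRHS](powRr0 s) ger_powR ?s0//.
  exact/ltW/time_exponent_gt0.
have -> : (Num.sqrt s)^-1 = (s `^ time_exponent q) `^ (- young_exponent q).
  rewrite -powRrM -powR12_sqrt ?(ltW s0)// -powRN; congr powR.
  rewrite /time_exponent /young_exponent mulrN; congr -%R.
  by field; rewrite -/(_ - _) !gt_eqF//= ?subr_gt0//; nra.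
set w := s `^ _ in w0 w1 *.
apply: le_trans (@powR_absorb q (2 - q^-1) w (1 + z) phi m b0 bq _ _ w0 hm) _.
- by rewrite lerDl.
- by rewrite phi0.
rewrite -/(young_exponent q).
have W1 : 1 <= w `^ (- young_exponent q).
  rewrite -[leLHS](powRr0 w) ger_powR ?w0// oppr_le0.
  by apply: divr_ge0; [exact: ltW|rewrite subr_ge0 ltW].
have F0 : 0 <= phi ^+ (2 * m.+1) by rewrite exprn_ge0.
have F1 : phi ^+ (2 * m.+1) <= 1 by rewrite exprn_ile1.
rewrite mulrDl mul1r addrA lerD2r.
apply: (@le_trans _ _ (2 `^ q * (1 + z `^ q) * phi ^+ (2 * m.+1) * w)).
  by rewrite !ler_wpM2r ?(ltW w0)// powR_1D_le// ltW.
rewrite [leLHS](_ : _ = 2 `^ q * (z `^ q * phi ^+ (2 * m.+1) * w) +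
  2 `^ q * (phi ^+ (2 * m.+1) * w)); last by ring.
rewrite lerD2l ler_wpM2l ?powR_ge0//.
apply: le_trans W1; by rewrite mulr_ile1 ?(ltW w0).
Qed.

End Young.


(** * The path metric *)

Section Metric.
Context {R : realType} {V : choiceType}.
Context (e : rel V) (rho : V -> V -> R) (e_sym : symmetric e)
  (e_conn : connected_graph e) (hrho : edge_length e rho).
Implicit Types (x y z o : V) (p : seq V).

Lemma path_length_ge0 x p : path e x p -> 0 <= path_length rho x p.
Proof.
elim: p x => //= y p IH x /andP[exy /IH]; apply: addr_ge0.
by apply: ltW; apply: hrho.1.
Qed.

Lemma path_length_cat x p p' :
  path_length rho x (p ++ p') = path_length rho x p + path_length rho (last x p) p'.
Proof. by elim: p x => [x|y p IH x] /=; rewrite ?add0r// IH addrA. Qed.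

Lemma path_dist_le_length x p : path e x p ->
  path_dist e rho x (last x p) <= path_length rho x p.
Proof.
move=> xp; apply: ge_inf; last by exists p.
by exists 0 => _ [p' [/path_length_ge0 + _ ->]].
Qed.

Lemma le_path_dist x y (c : R) :
  (forall p, path e x p -> last x p = y -> c <= path_length rho x p) ->
  c <= path_dist e rho x y.
Proof.
move=> H; apply: lb_le_inf.
  by have [p xp xy] := e_conn x y; exists (path_length rho x p), p.
by move=> _ [p [xp xy ->]]; apply: H.
Qed.

Lemma path_dist_ge0 x y : 0 <= path_dist e rho x y.
Proof. by apply: le_path_dist => p /path_length_ge0. Qed.

Lemma path_dist_self x : path_dist e rho x x = 0.
Proof.
by apply/eqP; rewrite eq_le path_dist_ge0 andbT (@path_dist_le_length x [::]).
Qed.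

Lemma path_dist_triangle x y z :
  path_dist e rho x z <= path_dist e rho x y + path_dist e rho y z.
Proof.
rewrite -lerBlDr; apply: le_path_dist => p xp xpy; rewrite lerBlDr addrC -lerBlDr.
apply: le_path_dist => p' yp ypz; rewrite lerBlDr addrC -xpy -path_length_cat.
rewrite -ypz -xpy -last_cat; apply: path_dist_le_length.
by rewrite cat_path xp xpy.
Qed.

Lemma path_dist_edge o x y : e x y ->
  `|path_dist e rho o x - path_dist e rho o y| <= rho x y.
Proof.
have le1 a b : e a b -> path_dist e rho o b - path_dist e rho o a <= rho a b.
  move=> ab; rewrite lerBlDl; apply: le_trans (path_dist_triangle o a b) _.
  rewrite lerD2l; apply: le_trans (@path_dist_le_length a [:: b] _) _ => /=.
    by rewrite ab.
  by rewrite addr0.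
move=> xy; have yx : e y x by rewrite e_sym.
have := le1 _ _ xy; have := le1 _ _ yx; rewrite -(hrho.2 _ _ xy) ler_norml.
by move=> yx1 xy1; apply/andP; split; lra.
Qed.

End Metric.

(** * Caccioppoli inequality on a finite set *)

Lemma big_seq_support {R : realType} {V : choiceType} (B K : seq V) (F : V -> R) :
  uniq B -> uniq K -> {subset B <= K} -> (forall x, x \notin B -> F x = 0) ->
  \sum_(x <- K) F x = \sum_(x <- B) F x.
Proof.
move=> uB uK BK F0; rewrite (fsbig_seq _ _ uK) (fsbig_seq _ _ uB); apply/esym/fsbig_widen => [x /BK//|x].
by move=> [_ /negP/F0].
Qed.

Lemma exprB_le {R : realType} (p r : R) (m : nat) : 0 <= p -> p <= r ->
  r ^+ m.+1 - p ^+ m.+1 <= m.+1%:R * r ^+ m * (r - p).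
Proof.
move=> p0 pr; rewrite subrXX mulrC ler_wpM2r ?subr_ge0//.
rewrite mulr_natl -[X in _ *+ X](card_ord m.+1) -sumr_const; apply: ler_sum => i _.
rewrite -[leRHS](_ : r ^+ (m - i) * r ^+ i = _); last by rewrite -exprD subnK// -ltnS.
rewrite ler_wpM2l ?exprn_ge0 ?(le_trans p0)//.
by rewrite lerXn2r// nnegrE// (le_trans p0).
Qed.

Section Caccioppoli.
Context {R : realType} {V : choiceType}.
Context (e : rel V) (mu : V -> V -> R) (sigma : V -> R) (rho : V -> V -> R).
Context (e_sym : symmetric e) (e_locfin : locally_finite_graph e)
  (hmu : edge_weight e mu) (hrho : edge_length e rho)
  (rho_adapted : adapted e mu sigma rho).
Context (nu_gt0 : forall x, 0 < vertex_nu e mu sigma x).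
Notation nu := (vertex_nu e mu sigma).

Lemma sum_neighborsE (K : seq V) (x : V) (F : V -> R) : uniq K ->
  (forall y, e x y -> y \in K) -> (forall y, ~~ e x y -> F y = 0) ->
  \sum_(y \in neighbors e x) F y = \sum_(y <- K) F y.
Proof.
move=> uK NK F0; rewrite fsbig_finite; last exact: e_locfin.
have uN : uniq (enum_fset (fset_set (neighbors e x))) := fset_uniq _.
apply/esym/big_seq_support => //.
  by move=> y; rewrite in_fset_set ?inE; [exact: NK|exact: e_locfin].
move=> y; rewrite in_fset_set; last exact: e_locfin.
by move=> /negP nxy; apply: F0; apply/negP => xy; apply: nxy; rewrite inE.
Qed.

Definition caccioppoli_constant (q : R) (m : nat) : R :=
  (2 + 4 / (1 - q^-1)) * m.+1%:R ^+ 2.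

Lemma caccioppoli_constant_ge0 (q : R) (m : nat) : 1 < q ->
  0 <= caccioppoli_constant q m.
Proof.
move=> q1; rewrite mulr_ge0 ?sqr_ge0// addr_ge0// divr_ge0// subr_ge0.
by rewrite invf_le1 ?ltW// (lt_trans _ q1).
Qed.

(** The cutoff enters with the power m + 1, and the difference of these powers
costs one factor chi, which is why the error carries chi^(2m). *)
Lemma caccioppoli_pair (q r : R) (m : nat) (chi z : V -> R) (x y : V) :
  1 < q -> 0 < r -> (forall x, 0 <= chi x) -> (forall x, 0 <= z x) ->
  (forall x y, e x y -> r * `|chi x - chi y| <= rho x y) -> e x y ->
  chi x <= chi y ->
  - (caccioppoli_constant q m / r ^+ 2 *
     (chi y ^+ (2 * m) * rho x y ^+ 2 * (1 + z y) `^ (2 - q^-1))) <=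
  (z y - z x) * (damping q (z x) * chi x ^+ (2 * m.+1)
                 - damping q (z y) * chi y ^+ (2 * m.+1)).
Proof.
move=> q1 r0 chi0 z0 lip xy chixy.
have := @caccioppoli_edge _ q (z x) (z y) (chi x ^+ m.+1) (chi y ^+ m.+1) q1
  (z0 x) (z0 y) (exprn_ge0 _ (chi0 x)).
have -> : chi x ^+ m.+1 <= chi y ^+ m.+1 by rewrite lerXn2r// nnegrE.
rewrite -!exprM ![(m.+1 * 2)%N]mulnC => /(_ isT); apply: le_trans.
rewrite lerN2 mulrCA.
rewrite /caccioppoli_constant -!mulrA ler_wpM2l//.
  rewrite addr_ge0// mulr_ge0// invr_ge0 subr_ge0.
  by rewrite invf_le1 ?ltW// (lt_trans _ q1).
rewrite !mulrA ler_wpM2r ?powR_ge0//.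
have lipxy : chi y - chi x <= rho x y / r.
  rewrite ler_pdivlMr// mulrC; apply: le_trans (lip _ _ xy).
  by rewrite ler_wpM2l ?(ltW r0)// distrC ler_norm.
rewrite (_ : _ * _ = (m.+1%:R * chi y ^+ m * (rho x y / r)) ^+ 2); last first.
  by rewrite mulnC exprM; field; rewrite gt_eqF.
have rho0 : 0 <= rho x y by rewrite ltW// hrho.1.
rewrite -expr2 lerXn2r// ?nnegrE ?subr_ge0//.
- by rewrite lerXn2r// nnegrE.
- by rewrite !mulr_ge0 ?exprn_ge0// invr_ge0 ltW.
by apply: le_trans (exprB_le _ (chi0 x) chixy) _; rewrite ler_wpM2l// mulr_ge0 ?exprn_ge0.
Qed.

(** The sum is symmetrised over a finite set K containing B and its neighbours.
Edges leaving B may be arbitrarily long: the pairwise error is charged to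
the end with the larger cutoff, so that only vertices of B are charged, and at
each of them adaptedness sums the squared lengths. *)
Lemma caccioppoli (q r : R) (m : nat) (B : seq V) (chi z : V -> R) :
  1 < q -> 0 < r -> (0 < m)%N -> uniq B ->
  (forall x, 0 <= chi x) -> (forall x, x \notin B -> chi x = 0) ->
  (forall x, 0 <= z x) ->
  (forall x y, e x y -> r * `|chi x - chi y| <= rho x y) ->
  - (caccioppoli_constant q m / r ^+ 2 *
     \sum_(x <- B) nu x * (chi x ^+ (2 * m) * (1 + z x) `^ (2 - q^-1))) <=
  \sum_(x <- B) nu x * (chi x ^+ (2 * m.+1) * damping q (z x) *
                        laplacian e mu sigma z x).
Proof.
move=> q1 r0 m0 uB chi0 chiB z0 lip.
have [mu_sym mu_gt0 mu_eq0] := hmu.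
have mu0 x y : 0 <= mu x y.
  by have [/mu_gt0/ltW//|/mu_eq0->] := boolP (e x y).
set C := caccioppoli_constant q m / r ^+ 2.
have C0 : 0 <= C.
  by apply: divr_ge0; rewrite ?sqr_ge0// caccioppoli_constant_ge0.
pose N x : seq V := fset_set (neighbors e x).
pose K := undup (B ++ flatten [seq N x | x <- B]).
have uK : uniq K := undup_uniq _.
have BK : {subset B <= K} by move=> x xB; rewrite mem_undup mem_cat xB.
have NK x : x \in B -> forall y, e x y -> y \in K.
  move=> xB y xy; rewrite mem_undup mem_cat; apply/orP; right.
  apply/flattenP; exists (N x); first by apply/mapP; exists x.
  by rewrite in_fset_set ?inE//; exact: e_locfin.
pose G x y := mu x y * (damping q (z x) * chi x ^+ (2 * m.+1) * (z y - z x)).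
pose E x y := C * (mu x y * rho x y ^+ 2 *
                   (chi x ^+ (2 * m) * (1 + z x) `^ (2 - q^-1))).
have E0 x y : 0 <= E x y.
  by apply: mulr_ge0 => //; apply: mulr_ge0; apply: mulr_ge0;
    rewrite ?sqr_ge0 ?powR_ge0 ?exprn_ge0.
have GE x y : - (E x y + E y x) <= G x y + G y x.
  have [exy|/mu_eq0 muxy] := boolP (e x y); last first.
    by rewrite /E /G (mu_sym y x) muxy !(mul0r, mulr0, addr0) oppr0.
  wlog chixy : x y exy / chi x <= chi y.
    have [xy|/ltW yx] := leP (chi x) (chi y); first by move=> H; apply: H.
    by rewrite addrC [leRHS]addrC => H; apply: H; rewrite // e_sym.
  have := caccioppoli_pair m q1 r0 chi0 z0 lip exy chixy.
  move=> /(ler_wpM2l (mu0 x y)) H.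
  have -> : G x y + G y x = mu x y * ((z y - z x) * (damping q (z x) *
      chi x ^+ (2 * m.+1) - damping q (z y) * chi y ^+ (2 * m.+1))).
    by rewrite /G (mu_sym y x); ring.
  apply: le_trans H; rewrite mulrN lerN2 -/C.
  have -> : mu x y * (C * (chi y ^+ (2 * m) * rho x y ^+ 2 *
      (1 + z y) `^ (2 - q^-1))) = E y x.
    by rewrite /E (mu_sym y x) (hrho.2 _ _ exy); ring.
  by rewrite lerDr.
have -> : \sum_(x <- B) nu x * (chi x ^+ (2 * m.+1) * damping q (z x) *
     laplacian e mu sigma z x) = \sum_(x <- K) \sum_(y <- K) G x y.
  rewrite (@big_seq_support _ _ B K) => //; last first.
    move=> x /chiB chix; rewrite big1// => y _.
    by rewrite /G chix expr0n/= !(mulr0, mul0r).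
  rewrite big_seq [RHS]big_seq; apply: eq_bigr => x xB.
  rewrite /laplacian (sum_neighborsE uK (NK _ xB)); last first.
    by move=> y /mu_eq0 ->; rewrite mul0r.
  rewrite !mulrA !mulr_sumr; apply: eq_bigr => y _; rewrite /G.
  by field; rewrite gt_eqF.
have swap : \sum_(x <- K) \sum_(y <- K) G y x = \sum_(x <- K) \sum_(y <- K) G x y.
  by rewrite exchange_big.
have swapE : \sum_(x <- K) \sum_(y <- K) E y x = \sum_(x <- K) \sum_(y <- K) E x y.
  by rewrite exchange_big.
have double : - (\sum_(x <- K) \sum_(y <- K) (E x y + E y x)) <=
    \sum_(x <- K) \sum_(y <- K) (G x y + G y x).
  rewrite -sumrN; apply: ler_sum => x _; rewrite -sumrN; apply: ler_sum => y _.
  exact: GE.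
have : \sum_(x <- K) \sum_(y <- K) E x y <= C *
    \sum_(x <- B) nu x * (chi x ^+ (2 * m) * (1 + z x) `^ (2 - q^-1)).
  rewrite (@big_seq_support _ _ B K) => //; last first.
    move=> x /chiB chix; rewrite big1// => y _.
    by rewrite /E chix expr0n muln_eq0/= eqn0Ngt m0 !(mulr0, mul0r).
  rewrite mulr_sumr big_seq [leRHS]big_seq; apply: ler_sum => x xB.
  rewrite -mulr_sumr ler_wpM2l// -mulr_suml ler_wpM2r//.
    by rewrite mulr_ge0 ?exprn_ge0 ?powR_ge0.
  rewrite -(sum_neighborsE uK (NK _ xB)); first exact: rho_adapted.
  by move=> y /mu_eq0 ->; rewrite mul0r.
move: double; under eq_bigr do rewrite big_split/=.
under [X in _ <= X -> _]eq_bigr do rewrite big_split/=.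
rewrite !big_split/= swap swapE; lra.
Qed.

End Caccioppoli.

(** * Integrals over time intervals *)

Section TimeIntegral.
Context {R : realType}.
Implicit Types (f g : R -> R) (a b t : R).

Definition continuous_pos f := forall t, 0 < t -> {for t, continuous f}.

Definition time_integral a b f : R :=
  \int[lebesgue_measure]_(t in `[a, b]) f t.

Lemma continuous_pos_cst (c : R) : continuous_pos (fun=> c).
Proof. by move=> t _; apply: cst_continuous. Qed.

Lemma continuous_posD f g : continuous_pos f -> continuous_pos g ->
  continuous_pos (fun t => f t + g t).
Proof. by move=> cf cg t t0; apply: cvgD; [exact: cf|exact: cg]. Qed.

Lemma continuous_posM f g : continuous_pos f -> continuous_pos g ->
  continuous_pos (fun t => f t * g t).
Proof. by move=> cf cg t t0; apply: cvgM; [exact: cf|exact: cg]. Qed.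

Lemma continuous_posX f n : continuous_pos f -> continuous_pos (fun t => f t ^+ n).
Proof.
move=> cf; elim: n => [|n IH].
  by under eq_fun do rewrite expr0; exact: continuous_pos_cst.
by under eq_fun do rewrite exprS; exact: continuous_posM.
Qed.

Lemma continuous_pos_sum (I : Type) (s : seq I) (F : I -> R -> R) :
  (forall i, continuous_pos (F i)) -> continuous_pos (fun t => \sum_(i <- s) F i t).
Proof.
move=> cF; elim: s => [|i s IH].
  by under eq_fun do rewrite big_nil; exact: continuous_pos_cst.
by under eq_fun do rewrite big_cons; exact: continuous_posD.
Qed.

Lemma continuous_pos_max0 f : continuous_pos f ->
  continuous_pos (fun t => Num.max 0 (f t)).
Proof.
move=> cf.
have -> : (fun t => Num.max 0 (f t)) = (fun t => (f t + `|f t|) / 2).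
  by apply/funext => t; rewrite maxr_absE add0r sub0r normrN.
move=> t t0.
apply: cvgM; last exact: cvg_cst.
by apply: cvgD; [exact: cf|apply: cvg_norm; exact: cf].
Qed.

Lemma continuous_pos_derivable f : (forall t, 0 < t -> derivable f t 1) ->
  continuous_pos f.
Proof.
by move=> df t t0; apply/differentiable_continuous/derivable1_diffP/df.
Qed.

(** The nonnegativity of f matters: [x `^ q] equals 1 for x < 0, so the power is
discontinuous at 0. *)
Lemma continuous_pos_powR f q : 1 < q -> (forall t, 0 < t -> 0 <= f t) ->
  continuous_pos f -> continuous_pos (fun t => f t `^ q).
Proof.
move=> q1 f0 cf t t0.
have [ft0|ftN0] := eqVneq (f t) 0; last first.
  have ft : 0 < f t by rewrite lt_neqAle eq_sym ftN0 f0.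
  apply: (@continuous_comp _ _ _ f (fun y : R => y `^ q)); first exact: cf.
  apply/differentiable_continuous/derivable1_diffP.
  by apply: derivable_powR; rewrite in_itv/= ft.
have q0 : 0 < q by apply: lt_trans q1.
rewrite /prop_for /continuous_at/= ft0 powR0 ?gt_eqF//.
have cft : f x @[x --> t] --> 0 by rewrite -ft0; exact: cf.
apply: (@squeeze_cvgr _ _ _ _ (fun=> 0) f) => //; last exact: cvg_cst.
near=> x.
have x0 : 0 < x by near: x; exact: lt_nbhsr.
have fx1 : f x < 1 by near: x; apply: (cvgr_lt 0).
rewrite powR_ge0/=; have [->|fxN0] := eqVneq (f x) 0; first by rewrite powR0 ?gt_eqF.
rewrite -[leRHS]powRr1 ?f0//; apply: ger_powR; last exact: ltW.
by rewrite lt_neqAle eq_sym fxN0 f0//= ltW.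
Unshelve. all: by end_near. Qed.

Lemma time_integrable a b f : 0 < a -> continuous_pos f ->
  (@lebesgue_measure R).-integrable `[a, b] (EFin \o f).
Proof.
move=> a0 cf; apply: continuous_compact_integrable; first exact: segment_compact.
apply: continuous_in_subspaceT => t; rewrite inE/= in_itv/= => /andP[at0 _].
by apply: cf; apply: lt_le_trans at0.
Qed.

Lemma le_time_integral a b f g : 0 < a -> continuous_pos f -> continuous_pos g ->
  (forall t, a <= t <= b -> f t <= g t) ->
  time_integral a b f <= time_integral a b g.
Proof.
move=> a0 cf cg fg; by apply: le_Rintegral => //; exact: time_integrable.
Qed.

Lemma time_integral_ge0 a b f : (forall t, a <= t <= b -> 0 <= f t) ->
  0 <= time_integral a b f.
Proof. by move=> f0; apply: Rintegral_ge0 => t; rewrite /= in_itv/=; exact: f0. Qed.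

Lemma time_integralZ a b f c : 0 < a -> continuous_pos f ->
  time_integral a b (fun t => c * f t) = c * time_integral a b f.
Proof. by move=> a0 cf; apply: RintegralZl => //; exact: time_integrable. Qed.

Lemma time_integralD a b f g : 0 < a -> continuous_pos f -> continuous_pos g ->
  time_integral a b (fun t => f t + g t) = time_integral a b f + time_integral a b g.
Proof. by move=> a0 cf cg; apply: RintegralD => //; exact: time_integrable. Qed.

Lemma time_integral_sum a b (I : Type) (s : seq I) (F : I -> R -> R) : 0 < a ->
  (forall i, continuous_pos (F i)) ->
  time_integral a b (fun t => \sum_(i <- s) F i t) =
  \sum_(i <- s) time_integral a b (F i).
Proof.
move=> a0 cF; elim: s => [|i s IH].
  rewrite big_nil /time_integral; under eq_Rintegral do rewrite big_nil.
  by rewrite Rintegral_cst// mul0r.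
rewrite big_cons -IH -time_integralD//; last exact: continuous_pos_sum.
by rewrite /time_integral; under eq_Rintegral do rewrite big_cons.
Qed.

Lemma time_integral_derivative a f t : 0 < a -> continuous_pos f -> a < t ->
  is_derive t 1 (fun b => time_integral a b f) (f t).
Proof.
move=> a0 cf at0.
have tu : t < t + 1 by rewrite ltrDl.
have [df Ef] := continuous_FTC1_closed tu (time_integrable (t + 1) a0 cf) at0
  (cf _ (lt_trans a0 at0)).
by have := derivableP df; rewrite -derive1E Ef.
Qed.

Lemma time_integral_split a b c f : 0 < a -> a <= b -> b <= c -> continuous_pos f ->
  time_integral a c f = time_integral a b f + time_integral b c f.
Proof.
move=> a0 ab bc cf; have intf := time_integrable c a0 cf.
rewrite /time_integral -(@Rintegral_itv_obnd_cbnd _ b); last first.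
  by apply: integrableS intf => //; apply: subset_itvr; rewrite bnd_simp.
by rewrite -(Rintegral_itvB intf) ?bnd_simp// addrC subrK.
Qed.

Lemma time_integral_mono a b c f : 0 < a -> a <= b -> b <= c -> continuous_pos f ->
  (forall t, b <= t <= c -> 0 <= f t) ->
  time_integral a b f <= time_integral a c f.
Proof.
move=> a0 ab bc cf f0.
by rewrite (time_integral_split a0 ab bc cf) lerDl time_integral_ge0.
Qed.

(** Y minus the primitive of f is nondecreasing, whatever the regularity of the
derivative of Y. *)
Lemma time_integral_le_increment a b f (Y dY : R -> R) : 0 < a -> a <= b ->
  continuous_pos f -> (forall t, 0 < t -> is_derive t 1 Y (dY t)) ->
  (forall t, a < t < b -> f t <= dY t) -> time_integral a b f <= Y b - Y a.
Proof.
move=> a0 ab cf dYE fdY; have a20 : 0 < a / 2 by rewrite divr_gt0.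
have a2a : a / 2 < a by rewrite ltr_pdivrMr// ltr_pMr// ltr1n.
pose G t := Y t - time_integral (a / 2) t f.
have dG t : a / 2 < t -> is_derive t 1 G (dY t - f t).
  move=> at0; have ? := dYE _ (lt_trans a20 at0).
  have ? := time_integral_derivative a20 cf at0.
  exact: is_deriveB.
have : G a <= G b.
  apply: (@ger0_derive1_ndecr _ G a b) => // [t|t|].
  - rewrite in_itv/= => /andP[at0 _].
    by have [] := dG _ (lt_trans a2a at0).
  - rewrite in_itv/= => /andP[at0 tb]; rewrite derive1E.
    have [_ ->] := dG _ (lt_trans a2a at0).
    by rewrite subr_ge0 fdY// at0.
  - apply: derivable_within_continuous => t; rewrite in_itv/= => /andP[at0 _].
    by have [] := dG _ (lt_le_trans a2a at0).
rewrite /G (time_integral_split a20 (ltW a2a) ab cf); lra.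
Qed.

(** If the integral vanished, the primitive would be constant and its derivative
f would vanish inside the interval. *)
Lemma time_integral_gt0 a b f t : 0 < a -> a < t < b -> continuous_pos f ->
  (forall s, a <= s <= b -> 0 <= f s) -> 0 < f t -> 0 < time_integral a b f.
Proof.
move=> a0 /andP[at0 tb] cf f0 ft; rewrite lt_neqAle time_integral_ge0// andbT.
apply/negP => /eqP/esym int0.
have const s : a < s < b -> time_integral a s f = 0.
  move=> /andP[as0 sb]; apply/eqP; rewrite eq_le; apply/andP; split.
    rewrite -int0; apply: time_integral_mono => //; try exact: ltW.
    by move=> r /andP[sr rb]; apply: f0; rewrite rb (le_trans (ltW as0)).
  by apply: time_integral_ge0 => r /andP[ar rs]; rewrite f0// ar (le_trans rs)// ltW.
have [_ ] := time_integral_derivative a0 cf at0.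
rewrite (@near_eq_derive _ _ _ _ (cst 0)); last first.
  near=> s; apply: const; apply/andP; split; near: s.
    exact: lt_nbhsr.
  exact: lt_nbhsl.
by rewrite -derive1E derive1_cst => f_0; rewrite -f_0 ltxx in ft.
Unshelve. all: by end_near. Qed.

End TimeIntegral.

(** * The tested inequality at a fixed time *)

Lemma damping_primitive_bounds {R : realType} (q z : R) : 1 < q -> 0 <= z ->
  0 <= damping_primitive q z <= (1 + q) * (1 + z) `^ (2 - q^-1).
Proof.
move=> q1 z0; have q0 : 0 < q by apply: lt_trans q1.
have qi1 : q^-1 < 1 by rewrite invf_lt1.
have qi0 : 0 < q^-1 by rewrite invr_gt0.
rewrite /damping_primitive; apply/andP; split.
  by rewrite addr_ge0// mulr_ge0 ?powR_ge0// ltW.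
rewrite mulrDl mul1r lerD//.
  apply: (@le_trans _ _ (1 + z)); first by rewrite lerDr.
  by rewrite -[leLHS]powRr1 ?addr_ge0// ler_powR ?lerDl//; lra.
by rewrite ler_wpM2l ?(ltW q0)// ler_powR ?lerDl//; lra.
Qed.

Lemma is_derive_damping_primitive {R : realType} (q z : R) : 1 < q -> 0 <= z ->
  is_derive z 1 (damping_primitive q) (damping q z).
Proof.
move=> q1 z0; have q0 : 0 < q by apply: lt_trans q1.
have z1 : 0 < 1 + z by rewrite ltr_pwDl.
have d1 : is_derive z 1 (fun z : R => 1 + z) 1.
  have : is_derive z 1 (cst 1 + id : R -> R) (0 + 1) by exact: is_deriveD.
  by rewrite add0r.
have d2 := @is_derive1_powR _ q^-1 _ z1.
have d3 := @is_derive1_comp _ (fun y : R => y `^ q^-1) (fun z : R => 1 + z) z _ _ d2 d1.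
have d4 := is_deriveD (is_derive_id z 1) (is_deriveZ q d3).
have -> : damping q z = 1 + q *: (q^-1 * (1 + z) `^ (q^-1 - 1) * 1).
  by rewrite /damping mulr1 /GRing.scale/= mulrA mulfV ?gt_eqF// mul1r.
exact: d4.
Qed.

Lemma is_derive_seq_sum {R : realType} (I : Type) (s : seq I) (F : I -> R -> R)
    (dF : I -> R) (t : R) : (forall i, is_derive t 1 (F i) (dF i)) ->
  is_derive t 1 (fun t => \sum_(i <- s) F i t) (\sum_(i <- s) dF i).
Proof.
move=> dFE; elim: s => [|i s IH].
  by under eq_fun do rewrite big_nil; rewrite big_nil; exact: is_derive_cst.
under eq_fun do rewrite big_cons; rewrite big_cons.
by have ? := dFE i; exact: is_deriveD.
Qed.

Lemma is_derive_divr {R : realType} (f : R -> R) (df c t : R) :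
  is_derive t 1 f df -> is_derive t 1 (fun s => f s / c) (df / c).
Proof.
move=> dfE; have -> : (fun s => f s / c) = c^-1 \*: f.
  by apply/funext => s; rewrite mulrC.
by rewrite mulrC; exact: is_deriveZ.
Qed.

Section Energy.
Context {R : realType} {V : choiceType}.
Context (e : rel V) (mu : V -> V -> R) (sigma : V -> R) (rho : V -> V -> R).
Context (e_sym : symmetric e) (e_locfin : locally_finite_graph e)
  (hmu : edge_weight e mu) (hrho : edge_length e rho)
  (rho_adapted : adapted e mu sigma rho).
Context (nu_gt0 : forall x, 0 < vertex_nu e mu sigma x).
Notation nu := (vertex_nu e mu sigma).

Lemma laplacianZ (c : R) (f : V -> R) (x : V) :
  laplacian e mu sigma (fun y => f y / c) x = laplacian e mu sigma f x / c.
Proof.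
rewrite /laplacian -mulrA mulr_fsuml; congr (_ * _).
by apply: eq_fsbigr => y _; rewrite -mulrBl mulrA.
Qed.

Definition energy_constant (q : R) (m : nat) : R :=
  caccioppoli_constant q m + (2 * m.+1)%:R * (1 + q).

Lemma energy_constant_ge0 (q : R) (m : nat) : 1 < q -> 0 <= energy_constant q m.
Proof.
move=> q1; rewrite addr_ge0 ?caccioppoli_constant_ge0// mulr_ge0// addr_ge0//.
by rewrite ltW// (lt_trans _ q1).
Qed.

(** The right-hand side is the time derivative of the sum of
nu chi^n zeta^n H(v / A), where n = 2m + 2 and H is the primitive of the
damping. The source is bounded below using that the damping is at least 1, the
diffusion by the Caccioppoli inequality, the derivative of the time cutoff by the
linear growth of H; Young's inequality then replaces both errors. *)
Lemma tested_supersolution_slice (q r A s zeta : R) (m : nat) (B : seq V)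
    (chi v dv : V -> R) :
  1 < q -> 0 < r -> 0 < A -> 0 < s <= 1 -> 0 <= zeta <= 1 ->
  (0 < m)%N -> young_exponent q <= m%:R -> uniq B ->
  (forall x, 0 <= chi x <= 1) -> (forall x, x \notin B -> chi x = 0) ->
  (forall x y, e x y -> r * `|chi x - chi y| <= rho x y) ->
  (forall x, 0 <= v x) ->
  (forall x, v x `^ q <= dv x - laplacian e mu sigma v x) ->
  A^-1 * \sum_(x <- B) nu x * (v x `^ q * (zeta * chi x) ^+ (2 * m.+1))
  - energy_constant q m / r ^+ 2 *
    (2 `^ q * A `^ (- q) * (\sum_(x <- B) nu x *
       (v x `^ q * (zeta * chi x) ^+ (2 * m.+1) * s `^ time_exponent q))
     + (2 `^ q + 1) * (\sum_(x <- B) nu x) * (Num.sqrt s)^-1) <=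
  \sum_(x <- B) nu x * (chi x ^+ (2 * m.+1) *
    (zeta ^+ (2 * m.+1) * (damping q (v x / A) * (dv x / A))
     - (2 * m.+1)%:R / r ^+ 2 * zeta ^+ (2 * m.+1).-1
       * damping_primitive q (v x / A))).
Proof.
move=> q1 r0 A0 s01 /andP[zeta0 zeta1] m0 hm uB chi01 chiB lip v0 super.
have q0 : 0 < q by apply: lt_trans q1.
have chi0 x : 0 <= chi x by have /andP[] := chi01 x.
have chi1 x : chi x <= 1 by have /andP[] := chi01 x.
have phi0 x : 0 <= zeta * chi x by rewrite mulr_ge0.
have phi1 x : zeta * chi x <= 1 by rewrite mulr_ile1.
pose z x := v x / A.
have z0 x : 0 <= z x by rewrite divr_ge0// ltW.
have n0 x : 0 <= nu x := ltW (nu_gt0 x).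
have r20 : 0 < r ^+ 2 by rewrite exprn_gt0.
pose P x := (1 + z x) `^ (2 - q^-1).
have P0 x : 0 <= P x by rewrite powR_ge0.
pose n := (2 * m.+1)%N.
have zetan : zeta ^+ n <= zeta ^+ (2 * m) by rewrite ler_wiXn2l// leq_mul2l leqnSn orbT.
have zetan1 : zeta ^+ n.-1 <= zeta ^+ (2 * m).
  by rewrite ler_wiXn2l// /n mulnS.
have chin x : chi x ^+ n <= chi x ^+ (2 * m).
  by rewrite ler_wiXn2l// leq_mul2l leqnSn orbT.
have spatial := caccioppoli e_sym e_locfin hmu hrho rho_adapted nu_gt0 q1 r0 m0 uB
  chi0 chiB z0 lip.
(* the errors of the diffusion and of the time cutoff have the same form *)
have step1 : A^-1 * \sum_(x <- B) nu x * (v x `^ q * (zeta * chi x) ^+ n)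
  - energy_constant q m / r ^+ 2 *
    \sum_(x <- B) nu x * ((zeta * chi x) ^+ (2 * m) * P x) <=
  \sum_(x <- B) nu x * (chi x ^+ n *
    (zeta ^+ n * (damping q (z x) * (dv x / A))
     - n%:R / r ^+ 2 * zeta ^+ n.-1 * damping_primitive q (z x))).
  have cost1 : - (caccioppoli_constant q m / r ^+ 2 *
      \sum_(x <- B) nu x * ((zeta * chi x) ^+ (2 * m) * P x)) <=
      zeta ^+ n * \sum_(x <- B) nu x * (chi x ^+ n * damping q (z x) *
                        laplacian e mu sigma z x).
    apply: le_trans (ler_wpM2l (exprn_ge0 n zeta0) spatial).
    rewrite mulrN lerN2 mulrCA ler_wpM2l ?divr_ge0 ?caccioppoli_constant_ge0 ?(ltW r20)//.
    rewrite mulr_sumr; apply: ler_sum => x _; rewrite exprMn mulrCA ler_wpM2l//.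
    by rewrite -mulrA ler_wpM2r// mulr_ge0 ?exprn_ge0 ?powR_ge0.
  have cost2 : n%:R / r ^+ 2 * zeta ^+ n.-1 *
      \sum_(x <- B) nu x * (chi x ^+ n * damping_primitive q (z x)) <=
      n%:R * (1 + q) / r ^+ 2 *
      \sum_(x <- B) nu x * ((zeta * chi x) ^+ (2 * m) * P x).
    rewrite !mulr_sumr; apply: ler_sum => x _.
    have /andP[H0 H1] := damping_primitive_bounds q1 (z0 x).
    rewrite [leLHS](_ : _ = nu x * (n%:R / r ^+ 2 * (zeta ^+ n.-1 * (chi x ^+ n *
       damping_primitive q (z x))))); last by ring.
    rewrite [leRHS](_ : _ = nu x * (n%:R / r ^+ 2 * (zeta ^+ (2 * m) *
       (chi x ^+ (2 * m) * ((1 + q) * P x))))); last first.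
      by rewrite exprMn; move: (zeta ^+ _) (chi x ^+ _) => a b; ring.
    rewrite ler_wpM2l// ler_wpM2l ?divr_ge0 ?(ltW r20)//.
    by do 2?[apply: ler_pM => //; rewrite ?mulr_ge0 ?exprn_ge0//].
  have source : A^-1 * \sum_(x <- B) nu x * (v x `^ q * (zeta * chi x) ^+ n) +
      zeta ^+ n * \sum_(x <- B) nu x * (chi x ^+ n * damping q (z x) *
                        laplacian e mu sigma z x) <=
      zeta ^+ n * \sum_(x <- B) nu x * (chi x ^+ n * (damping q (z x) * (dv x / A))).
    rewrite !mulr_sumr -big_split/=; apply: ler_sum => x _.
    have /andP[d1 _] := damping_bounds q1 (z0 x).
    rewrite [leLHS](_ : _ = nu x * zeta ^+ n * chi x ^+ n *
      (A^-1 * v x `^ q + damping q (z x) * laplacian e mu sigma z x)); last first.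
      by rewrite exprMn; ring.
    rewrite [leRHS](_ : _ = nu x * zeta ^+ n * chi x ^+ n *
      (damping q (z x) * (dv x / A))); last by ring.
    have w0 : 0 <= nu x * zeta ^+ n * chi x ^+ n.
      by apply: mulr_ge0; [apply: mulr_ge0|]; rewrite ?exprn_ge0.
    rewrite (ler_wpM2l w0)//.
    rewrite [laplacian e mu sigma z x]laplacianZ.
    have Ai0 : 0 < A^-1 by rewrite invr_gt0.
    have vq0 : 0 <= v x `^ q / A by rewrite mulr_ge0 ?powR_ge0 ?ltW.
    have H := ler_wpM2r (ltW Ai0) (super x); rewrite mulrBl in H.
    have := ler_wpM2l (le_trans ler01 d1) H.
    have : 1 * (v x `^ q / A) <= damping q (z x) * (v x `^ q / A) by rewrite ler_wpM2r.
    rewrite mulrBr mul1r; lra.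
  have -> : \sum_(x <- B) nu x * (chi x ^+ n *
    (zeta ^+ n * (damping q (z x) * (dv x / A))
     - n%:R / r ^+ 2 * zeta ^+ n.-1 * damping_primitive q (z x))) =
    zeta ^+ n * (\sum_(x <- B) nu x * (chi x ^+ n * (damping q (z x) * (dv x / A))))
    - n%:R / r ^+ 2 * zeta ^+ n.-1 *
      \sum_(x <- B) nu x * (chi x ^+ n * damping_primitive q (z x)).
    by rewrite !mulr_sumr -sumrB; apply: eq_bigr => x _; ring.
  move: cost1 cost2 source; rewrite /energy_constant -/n.
  set a1 := \sum_(x <- B) _ * (_ * P _).
  have -> : (caccioppoli_constant q m + n%:R * (1 + q)) / r ^+ 2 * a1 =
    caccioppoli_constant q m / r ^+ 2 * a1 + n%:R * (1 + q) / r ^+ 2 * a1 by ring.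
  lra.
apply: le_trans step1; rewrite lerD2l lerN2 ler_wpM2l//.
  by rewrite divr_ge0 ?energy_constant_ge0 ?ltW.
have zq x : z x `^ q = A `^ (- q) * v x `^ q.
  rewrite /z powRM ?invr_ge0 ?(ltW A0)// mulrC; congr (_ * _).
  by rewrite -powR_inv1 ?(ltW A0)// -powRrM mulN1r.
rewrite [X in _ <= _ + X]mulrAC [X in _ <= _ + X]mulrC mulr_suml mulr_sumr.
rewrite -big_split/=; apply: ler_sum => x _.
have := weighted_young q1 (z0 x) s01 (introT andP (conj (phi0 x) (phi1 x))) hm.
move=> /(ler_wpM2l (n0 x)) H; rewrite [_ * P x]mulrC; apply: le_trans H _.
rewrite zq le_eqVlt; apply/orP; left; apply/eqP.
by move: (_ ^+ _) => a; ring.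
Qed.

End Energy.

(** * The estimate at one scale *)

(** The amplitude A = X / (2 C M) makes the second term half of X,
so that it is absorbed on the left. *)
Lemma optimize_amplitude {R : realType} (q C T M X D : R) :
  1 < q -> 0 < C -> 0 < T -> 0 < M -> 0 <= X -> 0 <= D ->
  (forall A, 0 < A -> X <= C * (A `^ (1 - q) * D / T + A * M)) ->
  T * M `^ (1 - q) * X `^ q <= (2 * C) `^ q * D.
Proof.
move=> q1 C0 T0 M0 X0 D0 H; have q0 : 0 < q by apply: lt_trans q1.
have [->|XN0] := eqVneq X 0.
  by rewrite powR0 ?gt_eqF// mulr0 mulr_ge0// powR_ge0.
have {XN0}X0' : 0 < X by rewrite lt_neqAle eq_sym XN0.
have C20 : 0 < 2 * C by rewrite mulr_gt0.
pose A := X / (2 * C * M).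
have A0 : 0 < A by rewrite divr_gt0// mulr_gt0.
have AM : C * (A * M) = X / 2 by rewrite /A; field; rewrite !gt_eqF.
have := H _ A0; rewrite mulrDr AM => {}H.
have Aq : A `^ (1 - q) * (X * (T * M `^ (1 - q) * X `^ (q - 1) * (2 * C) `^ (1 - q))) =
    X * T.
  rewrite (_ : X `^ (q - 1) = (X `^ (1 - q))^-1); last by rewrite -powRN opprB.
  have XE : X `^ (1 - q) = A `^ (1 - q) * ((2 * C) `^ (1 - q) * M `^ (1 - q)).
    rewrite -powRM ?(ltW C20) ?(ltW M0)// -powRM ?(ltW A0)//; last first.
      by rewrite mulr_ge0 ?(ltW C20) ?(ltW M0).
    by congr powR; rewrite /A mulfVK// gt_eqF// mulr_gt0.
  rewrite XE; field.
  by rewrite !gt_eqF ?powR_gt0.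
have H2 : X * T <= 2 * C * (A `^ (1 - q) * D).
  have /(ler_wpM2r (ltW T0)) : X / 2 <= C * (A `^ (1 - q) * D / T) by lra.
  rewrite (_ : C * _ * T = C * (A `^ (1 - q) * D)); last by field; rewrite gt_eqF.
  lra.
have A1 : 0 < A `^ (1 - q) by rewrite powR_gt0.
rewrite -Aq (mulrCA _ (A `^ _)) ler_pM2l// in H2.
have := ler_wpM2r (powR_ge0 (2 * C) (q - 1)) H2.
have E1 : (2 * C) `^ (1 - q) * (2 * C) `^ (q - 1) = 1.
  by rewrite -(opprB q 1) powRN mulVf// gt_eqF// powR_gt0.
have E2 a : 0 < a -> a `^ q = a * a `^ (q - 1).
  move=> a0; rewrite -{2}[a]powRr1 ?ltW// -powRD; first by rewrite addrC subrK.
  by rewrite (gt_eqF a0) implybT.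
rewrite (E2 _ X0') (E2 _ C20).
rewrite (_ : X * _ * _ = T * M `^ (1 - q) * (X * X `^ (q - 1)) *
  ((2 * C) `^ (1 - q) * (2 * C) `^ (q - 1))); last by ring.
by rewrite E1 mulr1 [2 * C * D * _]mulrAC.
Qed.

Section Integrated.
Context {R : realType} {V : choiceType}.
Context (e : rel V) (mu : V -> V -> R) (sigma : V -> R) (rho : V -> V -> R).
Context (e_sym : symmetric e) (e_locfin : locally_finite_graph e)
  (hmu : edge_weight e mu) (hrho : edge_length e rho)
  (rho_adapted : adapted e mu sigma rho).
Context (nu_gt0 : forall x, 0 < vertex_nu e mu sigma x).
Notation nu := (vertex_nu e mu sigma).

Definition time_cutoff (T t : R) : R := Num.max 0 (1 - t / T).

Definition energy_density (q r : R) (m : nat) (B : seq V) (chi : V -> R)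
    (u : R -> V -> R) (t : R) : R :=
  \sum_(x <- B) nu x * (u t x `^ q * (time_cutoff (r ^+ 2) t * chi x) ^+ (2 * m.+1)).

Definition damped_density (q r : R) (m : nat) (B : seq V) (chi : V -> R)
    (u : R -> V -> R) (t : R) : R :=
  \sum_(x <- B) nu x * (u t x `^ q * (time_cutoff (r ^+ 2) t * chi x) ^+ (2 * m.+1)
    * (t / r ^+ 2) `^ time_exponent q).

Lemma continuous_pos_time_cutoff (T : R) : continuous_pos (time_cutoff T).
Proof.
apply: (@continuous_pos_max0 _ (fun t => 1 - t / T)) => t _.
apply: cvgB; first exact: cvg_cst.
by apply: cvgM; [exact: cvg_id|exact: cvg_cst].
Qed.

Lemma continuous_pos_energy_density q r m B chi u : 1 < q ->
  (forall t x, 0 < t -> 0 <= u t x) -> (forall x, continuous_pos (u ^~ x)) ->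
  continuous_pos (energy_density q r m B chi u).
Proof.
move=> q1 u0 cu; apply: continuous_pos_sum => x.
apply: continuous_posM; first exact: continuous_pos_cst.
apply: continuous_posM.
  by apply: (@continuous_pos_powR _ (u ^~ x)) => // t; exact: u0.
apply: continuous_posX; apply: continuous_posM; last exact: continuous_pos_cst.
exact: continuous_pos_time_cutoff.
Qed.

Lemma continuous_pos_damped_density q r m B chi u : 1 < q -> 0 < r ->
  (forall t x, 0 < t -> 0 <= u t x) -> (forall x, continuous_pos (u ^~ x)) ->
  continuous_pos (damped_density q r m B chi u).
Proof.
move=> q1 r0 u0 cu; apply: continuous_pos_sum => x.
apply: continuous_posM; first exact: continuous_pos_cst.
apply: continuous_posM.
  apply: continuous_posM.
    by apply: (@continuous_pos_powR _ (u ^~ x)) => // t; exact: u0.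
  apply: continuous_posX; apply: continuous_posM; last exact: continuous_pos_cst.
  exact: continuous_pos_time_cutoff.
apply: continuous_pos_derivable => t t0.
have tr0 : 0 < t / r ^+ 2 by rewrite divr_gt0 ?exprn_gt0.
have d1 := @is_derive1_powR _ (time_exponent q) _ tr0.
have d2 : is_derive t 1 (fun t : R => t / r ^+ 2) (1 / r ^+ 2).
  exact: (@is_derive_divr _ id 1 (r ^+ 2) t (is_derive_id t 1)).
by have [] := @is_derive1_comp _ (fun y : R => y `^ time_exponent q)
  (fun t : R => t / r ^+ 2) t _ _ d1 d2.
Qed.

Lemma is_derive_tested (q r A : R) (n : nat) (B : seq V) (chi : V -> R)
    (u : R -> V -> R) (t : R) : 1 < q -> 0 < A -> (forall x, 0 <= u t x) ->
  (forall x, derivable (u ^~ x) t 1) ->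
  is_derive t 1
    (fun t => \sum_(x <- B) nu x * (chi x ^+ n * ((1 - t / r ^+ 2) ^+ n *
      damping_primitive q (u t x / A))))
    (\sum_(x <- B) nu x * (chi x ^+ n * ((1 - t / r ^+ 2) ^+ n *
       (damping q (u t x / A) * (derive1 (u ^~ x) t / A))
     - n%:R / r ^+ 2 * (1 - t / r ^+ 2) ^+ n.-1
       * damping_primitive q (u t x / A)))).
Proof.
move=> q1 A0 u0 du; apply: (@is_derive_seq_sum _ _ B) => x.
have z0 : 0 <= u t x / A by rewrite divr_ge0// ltW.
have dux : is_derive t 1 (u ^~ x) (derive1 (u ^~ x) t).
  by apply: DeriveDef => //; rewrite derive1E.
have dz : is_derive t 1 (fun t => u t x / A) (derive1 (u ^~ x) t / A).
  exact: is_derive_divr.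
have dH := @is_derive1_comp _ (damping_primitive q) (fun t => u t x / A) t _ _
  (is_derive_damping_primitive q1 z0) dz.
have dl : is_derive t 1 (fun t : R => 1 - t / r ^+ 2) (- (r ^+ 2)^-1).
  have dt := @is_derive_divr _ id 1 (r ^+ 2) t (is_derive_id t 1).
  have : is_derive t 1 (cst 1 - (fun t : R => t / r ^+ 2) : R -> R)
    (0 - 1 / r ^+ 2) by exact: is_deriveB.
  by rewrite sub0r div1r.
have dln := @is_deriveX _ _ _ n t 1 _ dl.
have dp := @is_deriveM _ _ _ _ t 1 _ _ dln dH.
have dc := @is_deriveZ _ _ _ _ (nu x * chi x ^+ n) t 1 _ dp.
have -> : (fun t => nu x * (chi x ^+ n * ((1 - t / r ^+ 2) ^+ n *
      damping_primitive q (u t x / A)))) =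
  (nu x * chi x ^+ n) \*: ((fun t : R => 1 - t / r ^+ 2) ^+ n *
    (damping_primitive q \o (fun t => u t x / A))).
  by apply/funext => s; rewrite /= !fctE /= mulrA.
apply: is_derive_eq dc _.
rewrite /GRing.scale/=.
rewrite !fctE.
by move: (chi x ^+ n) (_ ^+ n) (_ ^+ n.-1) => a b c; ring.
Qed.

Definition integrated_constant (q : R) (m : nat) : R :=
  2 * energy_constant q m * (2 `^ q + 1).

(** Integration of the inequality at fixed times. The tested quantity vanishes
at t = r^2 and is nonnegative at t = tau, so it drops out. *)
Lemma amplitude_estimate (q r tau A : R) (m : nat) (B : seq V) (chi : V -> R)
    (u : R -> V -> R) :
  1 < q -> 0 < r -> 0 < tau <= r ^+ 2 -> 0 < A -> (0 < m)%N ->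
  young_exponent q <= m%:R -> uniq B ->
  (forall x, 0 <= chi x <= 1) -> (forall x, x \notin B -> chi x = 0) ->
  (forall x y, e x y -> r * `|chi x - chi y| <= rho x y) ->
  classical_supersolution e mu sigma q u ->
  time_integral tau (r ^+ 2) (energy_density q r m B chi u) <=
  integrated_constant q m *
    (A `^ (1 - q) * time_integral tau (r ^+ 2) (damped_density q r m B chi u) / r ^+ 2
     + A * \sum_(x <- B) nu x).
Proof.
move=> q1 r0 /andP[tau0 taur] A0 m0 hm uB chi01 chiB lip [u0 uC1 usuper].
have r20 : 0 < r ^+ 2 by rewrite exprn_gt0.
have cu x : continuous_pos (u ^~ x) by apply: continuous_pos_derivable; exact: (uC1 x).1.
have cE := @continuous_pos_energy_density q r m B chi u q1 u0 cu.
have cW := @continuous_pos_damped_density q r m B chi u q1 r0 u0 cu.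
set M := \sum_(x <- B) nu x.
pose K := energy_constant q m.
have K0 : 0 <= K by rewrite energy_constant_ge0.
pose k := K / r ^+ 2 * (2 `^ q * A `^ (- q)).
pose n := (2 * m.+1)%N.
pose Y (t : R) : R := \sum_(x <- B) nu x * (chi x ^+ n * ((1 - t / r ^+ 2) ^+ n *
      damping_primitive q (u t x / A))).
pose dY (t : R) : R := \sum_(x <- B) nu x * (chi x ^+ n * ((1 - t / r ^+ 2) ^+ n *
       (damping q (u t x / A) * (derive1 (u ^~ x) t / A))
     - n%:R / r ^+ 2 * (1 - t / r ^+ 2) ^+ n.-1
       * damping_primitive q (u t x / A))).
(* c sqrt(t) is a primitive of the error term in (r^2 / t)^(1/2) *)
pose c := K / r ^+ 2 * ((2 `^ q + 1) * M) * (2 * r).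
have dYc (t : R) : 0 < t -> is_derive t 1 (fun t => Y t + c * Num.sqrt t)
    (dY t + c * (2 * Num.sqrt t)^-1).
  move=> t0.
  have d1 : is_derive t 1 Y (dY t).
    by apply: is_derive_tested => // x; [exact: u0|exact: (uC1 x).1].
  have d2 := @is_deriveZ _ _ _ _ c t 1 _ (is_derive1_sqrt t0).
  exact: is_deriveD d1 d2.
have M0 : 0 <= M by apply: sumr_ge0 => x _; exact: ltW.
have c0 : 0 <= c.
  apply: mulr_ge0; last by rewrite mulr_ge0 ?(ltW r0).
  apply: mulr_ge0; first by rewrite divr_ge0 ?(ltW r20).
  by rewrite mulr_ge0 ?addr_ge0 ?powR_ge0.
have cf : continuous_pos (fun t => A^-1 * energy_density q r m B chi u t +
    (- k) * damped_density q r m B chi u t).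
  by apply: continuous_posD; apply: continuous_posM => //; exact: continuous_pos_cst.
have := time_integral_le_increment tau0 taur cf dYc.
have slice (t : R) : tau < t < r ^+ 2 -> A^-1 * energy_density q r m B chi u t +
    (- k) * damped_density q r m B chi u t <= dY t + c * (2 * Num.sqrt t)^-1.
  move=> /andP[taut tr]; have t0 : 0 < t := lt_trans tau0 taut.
  have s0 : 0 < t / r ^+ 2 by rewrite divr_gt0.
  have s1 : t / r ^+ 2 <= 1 by rewrite ler_pdivrMr// mul1r ltW.
  have zeta01 : 0 <= 1 - t / r ^+ 2 <= 1 by apply/andP; split; lra.
  have := tested_supersolution_slice (B := B) (chi := chi) (v := u t)
    (dv := fun x => derive1 (u ^~ x) t) e_sym e_locfin hmu hrho rho_adapted nu_gt0
    q1 r0 A0 (introT andP (conj s0 s1)) zeta01 m0 hm uB chi01 chiB lip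
    (fun x => u0 _ x t0) (fun x => usuper _ x t0).
  have zE : time_cutoff (r ^+ 2) t = 1 - t / r ^+ 2.
    by rewrite /time_cutoff max_r//; case/andP: zeta01.
  rewrite -/n -/(dY t) -/M -/K /energy_density /damped_density zE -/n.
  set E := \sum_(x <- B) _; set W := \sum_(x <- B) _.
  have -> : (Num.sqrt (t / r ^+ 2))^-1 = r / Num.sqrt t.
    by rewrite sqrtrM ?(ltW t0)// sqrtrV ?ltW// sqrtr_sqr gtr0_norm// invf_div.
  have -> : c * (2 * Num.sqrt t)^-1 = K / r ^+ 2 * ((2 `^ q + 1) * M * (r / Num.sqrt t)).
    by rewrite /c; field; rewrite !gt_eqF// sqrtr_gt0.
  rewrite /k mulrDr (mulrA (K / r ^+ 2) _ W) mulNr; lra.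
move=> /(_ slice) {slice}; rewrite time_integralD//; last 2 first.
- by apply: continuous_posM => //; exact: continuous_pos_cst.
- by apply: continuous_posM => //; exact: continuous_pos_cst.
rewrite !time_integralZ//.
set X := time_integral _ _ _; set D := time_integral _ _ _.
have YT : Y (r ^+ 2) = 0.
  rewrite /Y big1// => x _; rewrite divff ?gt_eqF// subrr expr0n/=.
  by rewrite mul0r !mulr0.
have Ytau : 0 <= Y tau.
  apply: sumr_ge0 => x _; apply: mulr_ge0; first exact: ltW.
  apply: mulr_ge0; first by rewrite exprn_ge0//; case/andP: (chi01 x).
  apply: mulr_ge0.
    by rewrite exprn_ge0// subr_ge0 ler_pdivrMr// mul1r.
  have z0 : 0 <= u tau x / A by apply: divr_ge0; [exact: u0|exact: ltW].
  by have /andP[] := damping_primitive_bounds q1 z0.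
have st0 : 0 <= c * Num.sqrt tau by rewrite mulr_ge0// sqrtr_ge0.
rewrite YT sqrtr_sqr gtr0_norm// add0r => H.
have {}H : A^-1 * X <= k * D + c * r by lra.
have := ler_wpM2l (ltW A0) H; rewrite mulVKf ?gt_eqF// => /le_trans; apply.
have D0 : 0 <= D.
  apply: time_integral_ge0 => t /andP[taut tr]; apply: sumr_ge0 => x _.
  apply: mulr_ge0; first exact: ltW.
  by rewrite !mulr_ge0 ?powR_ge0// exprn_even_ge0// oddM.
have AqE : A * A `^ (- q) = A `^ (1 - q).
  by rewrite -{1}[A]powRr1 ?ltW// -powRD// (gt_eqF A0) implybT.
have -> : A * (k * D + c * r) = K * (2 `^ q) * (A `^ (1 - q) * D / r ^+ 2) +
    integrated_constant q m * (A * M).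
  by rewrite -AqE /k /c /integrated_constant -/K; field; rewrite gt_eqF.
rewrite [leRHS]mulrDr lerD2r; apply: ler_wpM2r.
  by rewrite !mulr_ge0 ?powR_ge0// invr_ge0 ltW.
rewrite /integrated_constant -/K.
have := mulr_ge0 K0 (powR_ge0 2 q); lra.
Qed.

End Integrated.

(** * Summation over dyadic scales *)

Section Sequences.
Context {R : realType}.

(** Only the scales with 4^j > t contribute, and along them the terms form a
geometric progression starting below 1; the factor max(0, 1 - w_n) is what makes
the induction close. *)
Lemma sum_dyadic_powR_le (gamma t : R) (n : nat) : 0 < gamma -> 0 < t ->
  \sum_(j < n) (t < (2 ^+ j) ^+ 2)%R%:R * (t / (2 ^+ j) ^+ 2) `^ gamma <=
  (1 - (4^-1) `^ gamma)^-1 * Num.max 0 (1 - (t / (2 ^+ n) ^+ 2) `^ gamma).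
Proof.
move=> gamma0 t0; set lam := 4^-1 `^ gamma.
have lam1 : 0 < 1 - lam.
  rewrite subr_gt0 -[ltRHS](_ : 1 `^ gamma = 1); last by rewrite powR1.
  by rewrite gt0_ltr_powR ?nnegrE//; lra.
have C0 : 0 <= (1 - lam)^-1 by rewrite invr_ge0 ltW.
elim: n => [|n IH].
  by rewrite big_ord0 mulr_ge0// le_max lexx.
rewrite big_ord_recr/=.
have wS : (t / (2 ^+ n.+1) ^+ 2) `^ gamma = lam * (t / (2 ^+ n) ^+ 2) `^ gamma.
  rewrite -powRM ?divr_ge0 ?(ltW t0) ?sqr_ge0//; congr powR.
  by rewrite (exprS 2 n); field; rewrite gt_eqF// exprn_gt0.
have w0 : 0 <= (t / (2 ^+ n) ^+ 2) `^ gamma by rewrite powR_ge0.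
have T0 : 0 < (2 ^+ n) ^+ 2 :> R by rewrite !exprn_gt0.
rewrite wS; move: IH; set w := _ `^ gamma in w0 wS *.
have [tT|Tt] := ltP t ((2 ^+ n) ^+ 2).
  have w1 : w <= 1.
    rewrite -[leRHS](_ : 1 `^ gamma = 1); last by rewrite powR1.
    by rewrite ge0_ler_powR ?nnegrE ?(ltW gamma0)// ?divr_ge0 ?(ltW t0) ?(ltW T0)// ler_pdivrMr// mul1r ltW.
  rewrite max_r ?subr_ge0// => IH; rewrite mul1r.
  have lw1 : lam * w <= 1 by rewrite mulr_ile1 ?powR_ge0//; lra.
  rewrite max_r ?subr_ge0//; apply: le_trans (_ : (1 - lam)^-1 * (1 - w) + w <= _).
    by rewrite lerD2r.
  have -> : 1 - lam * w = (1 - w) + (1 - lam) * w by ring.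
  by rewrite [leRHS]mulrDr mulrA mulVf ?gt_eqF// mul1r.
have w1 : 1 <= w.
  rewrite -[leLHS](_ : 1 `^ gamma = 1); last by rewrite powR1.
  by rewrite ge0_ler_powR ?nnegrE ?(ltW gamma0)// ?divr_ge0 ?(ltW t0) ?(ltW T0)// ler_pdivlMr// mul1r.
rewrite max_l ?subr_le0// mulr0 mul0r addr0 => /le_trans; apply.
by rewrite mulr_ge0// le_max lexx.
Qed.

(** The recursion bounds g by the difference quotient K (S_(n+1) - S_n) / S_(n+1)^q,
which is a lower Riemann sum for the integral of K / S^q. *)
Lemma telescoping_bound (q K : R) (g S : nat -> R) (n0 : nat) : 1 < q -> 0 <= K ->
  0 < S n0 -> (forall n, S n <= S n.+1) ->
  (forall n, g n.+1 * S n.+1 `^ q <= K * (S n.+1 - S n)) ->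
  forall k, \sum_(n0 <= n < n0 + k) g n.+1 <=
            K / (q - 1) * (S n0 `^ (1 - q) - S (n0 + k)%N `^ (1 - q)).
Proof.
move=> q1 K0 S0 Smono rec k.
have Spos n : 0 < S (n0 + n)%N.
  by elim: n => [|n IH]; rewrite ?addn0// addnS (lt_le_trans IH).
have q10 : 0 < q - 1 by rewrite subr_gt0.
elim: k => [|k IH]; first by rewrite addn0 big_geq// subrr mulr0.
rewrite addnS big_nat_recr ?leq_addr//=; set n := (n0 + k)%N in IH *.
have := powR_lower_slope (ltW q10) (Spos k) _ (Smono n).
have Sn1 : 0 < S n.+1 by rewrite -addnS.
move=> /(_ Sn1); rewrite -/n opprB (_ : 1 - q - 1 = - q); last by ring.
move=> slope; have Kq : 0 <= K / (q - 1) by rewrite divr_ge0// ltW.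
have := ler_wpM2l Kq slope.
have H := ler_wpM2r (powR_ge0 (S n.+1) (- q)) (rec n).
have E : S n.+1 `^ q * S n.+1 `^ (- q) = 1.
  by rewrite powRN mulfV// gt_eqF// powR_gt0.
rewrite -mulrA E mulr1 in H; move: H.
have -> : K / (q - 1) * ((q - 1) * (S n.+1 - S n) * S n.+1 `^ (- q)) =
  K * (S n.+1 - S n) * S n.+1 `^ (- q) by field; rewrite gt_eqF.
have -> : K / (q - 1) * (S n0 `^ (1 - q) - S n.+1 `^ (1 - q)) =
  K / (q - 1) * (S n0 `^ (1 - q) - S n `^ (1 - q)) +
  K / (q - 1) * (S n `^ (1 - q) - S n.+1 `^ (1 - q)) by ring.
lra.
Qed.

Lemma sum_nat_le_shifted (g : nat -> R) (C : R) (k : nat) :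
  (forall j, 0 <= g j) -> (forall n, \sum_(k <= j < k + n) g j.+1 <= C) ->
  forall n, \sum_(0 <= j < n) g j <= \sum_(0 <= j < k.+1) g j + C.
Proof.
move=> g0 tail n; apply: (@le_trans _ _ (\sum_(0 <= j < k.+1 + n) g j)).
  rewrite (@big_cat_nat _ _ _ n 0 (k.+1 + n))//= ?leq_addl//.
  by rewrite lerDl; apply: sumr_ge0.
rewrite (@big_cat_nat _ _ _ k.+1 0 (k.+1 + n))//= ?leq_addr// lerD2l.
by rewrite addSn big_add1; exact: tail.
Qed.

Lemma sum_nat_tail_le (g : nat -> R) (k n : nat) : (forall j, 0 <= g j) ->
  \sum_(k <= j < k + n) g j <= \sum_(0 <= j < k + n) g j.
Proof.
move=> g0; rewrite [leRHS](@big_cat_nat _ _ _ k 0 (k + n))//= ?leq_addr//.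
by rewrite lerDr; apply: sumr_ge0.
Qed.

End Sequences.

Section Dyadic.
Context {R : realType} {V : choiceType}.
Context (e : rel V) (mu : V -> V -> R) (sigma : V -> R) (rho : V -> V -> R).
Context (e_sym : symmetric e) (e_locfin : locally_finite_graph e)
  (e_conn : connected_graph e)
  (hmu : edge_weight e mu) (hrho : edge_length e rho)
  (rho_adapted : adapted e mu sigma rho) (rho_proper : proper_dist e rho).
Context (nu_gt0 : forall x, 0 < vertex_nu e mu sigma x).
Notation nu := (vertex_nu e mu sigma).

Definition ball_seq (o : V) (r : R) : seq V := enum_fset (fset_set (dist_ball e rho o r)).

Definition space_cutoff (o : V) (r : R) (x : V) : R :=
  Num.max 0 (1 - path_dist e rho o x / r).

Lemma mem_ball_seq o r x : (x \in ball_seq o r) = (path_dist e rho o x <= r).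
Proof.
rewrite /ball_seq in_fset_set; last exact: rho_proper.
by apply/idP/idP; rewrite inE.
Qed.

Lemma ball_volumeE o r :
  ball_volume e mu sigma rho o r = \sum_(x <- ball_seq o r) nu x.
Proof. by rewrite /ball_volume /nu_measure fsbig_finite//; exact: rho_proper. Qed.

Lemma ball_volume_gt0 o r : 0 <= r -> 0 < ball_volume e mu sigma rho o r.
Proof.
move=> r0; rewrite ball_volumeE; have oB : o \in ball_seq o r.
  by rewrite mem_ball_seq (path_dist_self e_conn hrho).
rewrite (big_rem o oB)/= ltr_pwDl//.
by apply: sumr_ge0 => x _; exact: ltW.
Qed.

Lemma ball_volume_subset o o' r r' :
  (forall x, path_dist e rho o x <= r -> path_dist e rho o' x <= r') ->
  ball_volume e mu sigma rho o r <= ball_volume e mu sigma rho o' r'.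
Proof.
move=> sub; rewrite !ball_volumeE.
pose F x := (x \in ball_seq o r)%:R * nu x.
rewrite big_seq (eq_bigr F); last by move=> x xB; rewrite /F xB mul1r.
rewrite -big_seq -(@big_seq_support _ _ (ball_seq o r) (ball_seq o' r')); rewrite ?fset_uniq//.
- apply: ler_sum => x _; rewrite /F; case: (_ \in _); rewrite ?mul1r// mul0r.
  exact: ltW.
- by move=> x; rewrite !mem_ball_seq; exact: sub.
- by move=> x /negPf xB; rewrite /F xB mul0r.
Qed.

Lemma space_cutoff_bounds o r x : 0 < r -> 0 <= space_cutoff o r x <= 1.
Proof.
move=> r0; rewrite /space_cutoff le_max lexx/= ge_max ler01/= gerBl.
by rewrite divr_ge0 ?(ltW r0)//; exact: path_dist_ge0.
Qed.

Lemma space_cutoff_out o r x : 0 < r -> x \notin ball_seq o r ->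
  space_cutoff o r x = 0.
Proof.
move=> r0; rewrite mem_ball_seq -ltNge => rx; apply/max_l.
by rewrite subr_le0 ler_pdivlMr// mul1r ltW.
Qed.

Lemma max0_lipschitz (a b : R) : `|Num.max 0 a - Num.max 0 b| <= `|a - b|.
Proof.
rewrite !maxEle; case: (leP 0 a) (leP 0 b) => a0 [] b0; rewrite ?subr0 ?sub0r ?subrr ?normr0//.
- by rewrite ger0_norm// ger0_norm; lra.
- by rewrite normrN ger0_norm// ltr0_norm; lra.
Qed.

Lemma space_cutoff_lipschitz o r x y : 0 < r -> e x y ->
  r * `|space_cutoff o r x - space_cutoff o r y| <= rho x y.
Proof.
move=> r0 xy; apply: le_trans (path_dist_edge e_sym e_conn hrho o xy).
apply: le_trans (ler_wpM2l (ltW r0) (max0_lipschitz _ _)) _.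
rewrite (_ : 1 - _ - _ = (path_dist e rho o y - path_dist e rho o x) / r); last by ring.
by rewrite normrM (gtr0_norm (_ : 0 < r^-1)) ?invr_gt0// mulrCA mulfV ?gt_eqF// mulr1 distrC.
Qed.

Context (q : R) (m : nat) (o : V) (u : R -> V -> R) (tau : R)
  (q1 : 1 < q) (m0 : (0 < m)%N) (hm : young_exponent q <= m%:R)
  (hu : classical_supersolution e mu sigma q u) (tau01 : 0 < tau <= 1).

Let radius (j : nat) : R := 2 ^+ j.
Let energy j := energy_density e mu sigma q (radius j) m (ball_seq o (radius j))
  (space_cutoff o (radius j)) u.
Let damped j := damped_density e mu sigma q (radius j) m (ball_seq o (radius j))
  (space_cutoff o (radius j)) u.
Let X j := time_integral tau (radius j ^+ 2) (energy j).
Let D j := time_integral tau (radius j ^+ 2) (damped j).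
Let g j := radius j ^+ 2 * ball_volume e mu sigma rho o (radius j) `^ (1 - q).
Let S n := \sum_(j < n.+1) D j.

Let radius_gt0 j : 0 < radius j. Proof. exact: exprn_gt0. Qed.

Let radius_ge1 j : 1 <= radius j. Proof. by rewrite exprn_ege1// ler1n. Qed.

Let tau_radius j : tau <= radius j ^+ 2.
Proof. by case/andP: tau01 => _ /le_trans; apply; exact: exprn_ege1. Qed.

Let tau_gt0 : 0 < tau. Proof. by case/andP: tau01. Qed.

Let radius_le i j : (i <= j)%N -> radius i <= radius j.
Proof. by move=> ij; rewrite ler_weXn2l// ler1n. Qed.

Let u_ge0 t x : 0 < t -> 0 <= u t x. Proof. by case: hu => + _ _; apply. Qed.

Let u_continuous x : continuous_pos (u ^~ x).
Proof. by have [_ uC1 _] := hu; exact: continuous_pos_derivable (uC1 x).1. Qed.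

Let continuous_energy j : continuous_pos (energy j).
Proof. exact: continuous_pos_energy_density. Qed.

Let continuous_damped j : continuous_pos (damped j).
Proof. exact: continuous_pos_damped_density. Qed.

Let damped_ge0 j t : 0 <= damped j t.
Proof.
apply: sumr_ge0 => x _; apply: mulr_ge0; first exact: ltW.
by rewrite !mulr_ge0 ?powR_ge0// exprn_even_ge0// oddM.
Qed.

Let energy_ge0 j t : 0 <= energy j t.
Proof.
apply: sumr_ge0 => x _; apply: mulr_ge0; first exact: ltW.
by rewrite !mulr_ge0 ?powR_ge0// exprn_even_ge0// oddM.
Qed.

Let D_ge0 j : 0 <= D j. Proof. by apply: time_integral_ge0. Qed.

Let integrated_constant_gt0 : 0 < integrated_constant q m.
Proof.
apply: mulr_gt0; last by rewrite ltr_wpDl ?powR_ge0.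
apply: mulr_gt0 => //; rewrite ltr_wpDl ?caccioppoli_constant_ge0// mulr_gt0 ?ltr0n//.
by have := q1; lra.
Qed.

Let scale_estimate j :
  g j * X j `^ q <= (2 * integrated_constant q m) `^ q * D j.
Proof.
apply: optimize_amplitude => //; rewrite ?exprn_gt0//.
- exact/ball_volume_gt0/ltW.
- by apply: time_integral_ge0.
move=> A A0; rewrite ball_volumeE.
apply: (amplitude_estimate (rho := rho)) => //; rewrite ?tau_gt0 ?tau_radius ?fset_uniq//.
- by move=> x; exact: space_cutoff_bounds.
- by move=> x; exact: space_cutoff_out.
- by move=> x y; exact: space_cutoff_lipschitz.
Qed.

Let decay : R := (1 - 4^-1 `^ time_exponent q)^-1.

Let cutoff_le i j t x : (i <= j)%N -> 0 < t ->
  time_cutoff (radius i ^+ 2) t * space_cutoff o (radius i) x <=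
  time_cutoff (radius j ^+ 2) t * space_cutoff o (radius j) x.
Proof.
move=> ij t0; rewrite /time_cutoff /space_cutoff.
have mono (a b : R) : a <= b -> Num.max 0 a <= Num.max 0 b.
  by move=> ab; rewrite ge_max !le_max lexx ab orbT.
apply: ler_pM; [by rewrite le_max lexx|by rewrite le_max lexx|apply: mono|apply: mono];
  rewrite lerD2l lerN2.
  rewrite ler_wpM2l ?(ltW t0)// lef_pV2 ?posrE ?exprn_gt0//.
  by rewrite lerXn2r ?nnegrE ?(ltW (radius_gt0 _))// radius_le.
rewrite ler_wpM2l//; first exact: path_dist_ge0.
by rewrite lef_pV2 ?posrE// radius_le.
Qed.

(** Cutoffs increase with the scale, so all those up to scale n are bounded by
the last one, and the weights sum to a constant. *)
Let sum_damped_le n t : 0 < t ->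
  \sum_(j < n.+1) damped j t <= decay * energy n t.
Proof.
move=> t0.
have widen (j : 'I_n.+1) : damped j t = \sum_(x <- ball_seq o (radius n))
   nu x * (u t x `^ q * (time_cutoff (radius j ^+ 2) t *
     space_cutoff o (radius j) x) ^+ (2 * m.+1) *
     (t / radius j ^+ 2) `^ time_exponent q).
  apply/esym/big_seq_support; rewrite ?fset_uniq//.
    move=> x; rewrite !mem_ball_seq => /le_trans; apply; apply: radius_le.
    by rewrite -ltnS.
  move=> x /space_cutoff_out ->//.
  by rewrite mulr0 expr0n/= !(mulr0, mul0r).
rewrite (eq_bigr _ (fun j _ => widen j)) exchange_big/= mulr_sumr.
apply: ler_sum => x _; rewrite -mulr_sumr mulrCA ler_wpM2l//; first exact: ltW.
under eq_bigr do rewrite -mulrA.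
rewrite -mulr_sumr mulrCA ler_wpM2l ?powR_ge0//.
set phi := time_cutoff _ t * _.
apply: (@le_trans _ _ (phi ^+ (2 * m.+1) * \sum_(j < n.+1)
    (t < (2 ^+ j) ^+ 2)%R%:R * (t / (2 ^+ j) ^+ 2) `^ time_exponent q)).
  rewrite mulr_sumr; apply: ler_sum => j _.
  have [tT|Tt] := ltP t ((2 ^+ j) ^+ 2).
    rewrite mul1r ler_wpM2r ?powR_ge0// lerXn2r ?nnegrE//.
    - by rewrite mulr_ge0// le_max lexx.
    - by rewrite mulr_ge0// le_max lexx.
    - by apply: cutoff_le => //; rewrite -ltnS.
  rewrite /time_cutoff max_l; first by rewrite mul0r expr0n/= !mul0r mulr0.
  by rewrite subr_le0 ler_pdivlMr ?mul1r// exprn_gt0.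
rewrite mulrC ler_wpM2r//; first by rewrite exprn_even_ge0// oddM.
apply: le_trans (sum_dyadic_powR_le n.+1 (time_exponent_gt0 q1) t0) _.
rewrite -[leRHS]mulr1; apply: ler_wpM2l.
  rewrite invr_ge0 subr_ge0 -[leRHS](_ : 1 `^ time_exponent q = 1); last by rewrite powR1.
  by rewrite ge0_ler_powR ?nnegrE ?(ltW (time_exponent_gt0 q1))//; lra.
by rewrite ge_max ler01/= gerBl powR_ge0.
Qed.

Let S_le_X n : S n <= decay * X n.
Proof.
rewrite -time_integralZ//.
apply: (@le_trans _ _ (time_integral tau (radius n ^+ 2)
    (fun t => \sum_(j < n.+1) damped j t))).
  rewrite (@time_integral_sum _ _ _ _ _ (fun j : 'I_n.+1 => damped j))//.
  apply: ler_sum => j _; apply: time_integral_mono => //.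
  rewrite lerXn2r ?nnegrE ?(ltW (radius_gt0 _))// radius_le//.
  by rewrite -ltnS.
apply: le_time_integral => //.
- by apply: (@continuous_pos_sum _ _ _ (fun j : 'I_n.+1 => damped j)).
- by apply: continuous_posM => //; exact: continuous_pos_cst.
- by move=> t /andP[taut _]; apply: sum_damped_le; apply: lt_le_trans taut.
Qed.

(** Since D_(n+1) is the increment of S and S is bounded by a multiple of X, the
estimate at one scale becomes a superlinear recursion for S alone. *)
Let recursion : exists2 K : R, 0 <= K &
  forall n, g n.+1 * S n.+1 `^ q <= K * (S n.+1 - S n).
Proof.
have q0 : 0 <= q by have := q1; lra.
exists (decay `^ q * (2 * integrated_constant q m) `^ q).
  by rewrite mulr_ge0 ?powR_ge0.
move=> n; have -> : S n.+1 - S n = D n.+1.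
  by rewrite [S n.+1]big_ord_recr/= addrAC subrr add0r.
have S0 k : 0 <= S k by apply: sumr_ge0 => j _; exact: D_ge0.
have X0 k : 0 <= X k by apply: time_integral_ge0.
have decay0 : 0 <= decay.
  rewrite invr_ge0 subr_ge0 -[leRHS](_ : 1 `^ time_exponent q = 1); last by rewrite powR1.
  by rewrite ge0_ler_powR ?nnegrE ?(ltW (time_exponent_gt0 q1))//; lra.
have g0 : 0 <= g n.+1 by rewrite mulr_ge0 ?powR_ge0// sqr_ge0.
apply: (@le_trans _ _ (decay `^ q * (g n.+1 * X n.+1 `^ q))).
  rewrite mulrCA ler_wpM2l// -powRM// ge0_ler_powR ?nnegrE//.
  by rewrite mulr_ge0.
by rewrite -mulrA ler_wpM2l ?powR_ge0.
Qed.

Lemma dyadic_sum_bounded (t : R) (x : V) : tau < t -> 0 < u t x ->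
  exists K : R, forall n, \sum_(0 <= j < n) g j <= K.
Proof.
move=> taut utx; have t0 : 0 < t := lt_trans tau_gt0 taut.
have d0 : 0 <= path_dist e rho o x by exact: path_dist_ge0.
have [n0 tn0 dn0] : exists2 n, t < radius n ^+ 2 & path_dist e rho o x < radius n.
  pose n := Num.bound (t + path_dist e rho o x).
  have tdn : t + path_dist e rho o x < n%:R.
    by apply: archi_boundP; rewrite addr_ge0// ltW.
  have nrad : n%:R <= radius n.
    by rewrite /radius -natrX ler_nat ltnW// ltn_expl.
  exists n; last lra.
  have : radius n * 1 <= radius n * radius n by rewrite ler_wpM2l// ltW.
  by rewrite expr2 mulr1; lra.
have phi0 : 0 < time_cutoff (radius n0 ^+ 2) t * space_cutoff o (radius n0) x.
  by rewrite mulr_gt0// lt_max subr_gt0 ltr_pdivrMr ?exprn_gt0// mul1r ?tn0 ?dn0 orbT.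
have Dn0 : 0 < D n0.
  apply: (@time_integral_gt0 _ _ _ _ t) => //; first by rewrite taut.
  have xB : x \in ball_seq o (radius n0) by rewrite mem_ball_seq ltW.
  rewrite /damped /damped_density (big_rem x xB)/= ltr_pwDl//.
    apply: mulr_gt0; first exact: nu_gt0.
    apply: mulr_gt0; last by rewrite powR_gt0// divr_gt0// exprn_gt0.
    by apply: mulr_gt0; [exact: powR_gt0|exact: exprn_gt0].
  apply: sumr_ge0 => y _; apply: mulr_ge0; first exact: ltW.
  by rewrite !mulr_ge0 ?powR_ge0// exprn_even_ge0// oddM.
have Smono n : S n <= S n.+1 by rewrite [S n.+1]big_ord_recr/= lerDl D_ge0.
have S0 : 0 < S n0.
  rewrite /S big_ord_recr/= ltr_wpDl//; apply: sumr_ge0 => j _; exact: D_ge0.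
have [K K0 rec] := recursion.
have g0 j : 0 <= g j by rewrite mulr_ge0 ?powR_ge0// sqr_ge0.
have bound := telescoping_bound q1 K0 S0 Smono rec.
exists (\sum_(0 <= j < n0.+1) g j + K / (q - 1) * S n0 `^ (1 - q)).
apply: (sum_nat_le_shifted g0) => n; apply: le_trans (bound n) _.
rewrite ler_wpM2l ?gerBl ?powR_ge0// divr_ge0//.
by have := q1; lra.
Qed.

End Dyadic.

(** * The volume integral as a dyadic series *)

Section VolumeIntegral.
Context {R : realType} (q : R) (M : R -> R).
Context (q1 : 1 < q) (M_mono : {homo M : r s / r <= s})
  (M_gt0 : forall r, 0 <= r -> 0 < M r).

Notation mu := (@lebesgue_measure R).

Definition dyadic_term (j : nat) : R := (2 ^+ j) ^+ 2 * M (2 ^+ j) `^ (1 - q).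

Let f (r : R) : R := r / M r `^ (q - 1).

Let shell (k : nat) : set R := `[2 ^+ k, 2 ^+ k.+1[.

Lemma bigcup_dyadic_shells : \bigcup_k shell k = `[1, +oo[%classic.
Proof.
apply/seteqP; split => [r [k _]|r] /=.
  rewrite /shell/= !in_itv/= andbT => /andP[kr _].
  by apply: le_trans kr; rewrite exprn_ege1// ler1n.
rewrite in_itv/= andbT => r1.
have [n rn] : exists n, r < 2 ^+ n.
  exists (Num.bound r); apply: (@lt_trans _ _ (Num.bound r)%:R).
    by apply: archi_boundP; exact: le_trans r1.
  by rewrite -natrX ltr_nat ltn_expl.
elim: n rn => [|n IH] rn; first by rewrite expr0 ltNge r1 in rn.
have [rn'|nr] := ltP r (2 ^+ n); first exact: IH.
by exists n => //; rewrite /shell/= in_itv/= nr.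
Qed.

Lemma trivIset_dyadic_shells : trivIset [set: nat] shell.
Proof.
apply/trivIsetP => i j _ _; wlog ij : i j / (i < j)%N.
  by move=> H; rewrite neq_ltn => /orP[ij|ji]; [|rewrite setIC]; apply: H; rewrite // ltn_eqF.
move=> _; apply/seteqP; split => // r []; rewrite /shell/= !in_itv/= => /andP[_ ri] /andP[jr _].
have : 2 ^+ i.+1 <= 2 ^+ j :> R by rewrite ler_weXn2l// ler1n.
by move=> ?; lra.
Qed.

Let measurable_f (D : set (measurableTypeR R)) : measurable D ->
  measurable_fun D (EFin \o f).
Proof.
move=> mD; apply/measurable_EFinP; apply: measurable_funM => //.
have -> : (fun r => (M r `^ (q - 1))^-1) = (powR (R:=R) ^~ (- (q - 1))) \o M.
  by apply/funext => r /=; rewrite powRN.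
apply: measurableT_comp; first exact: measurable_powR.
exact: nondecreasing_measurable.
Qed.

Let f_ge0 r : 0 <= r -> 0 <= f r.
Proof. by move=> r0; rewrite divr_ge0// powR_ge0. Qed.

Let shell_ge0 k r : shell k r -> 0 <= r.
Proof.
by rewrite /shell/= in_itv/= => /andP[+ _]; apply: le_trans; exact: exprn_ge0.
Qed.

Let integral_shellE : (\int[mu]_(r in `[1%R, +oo[) (f r)%:E =
  \sum_(0 <= k <oo) \int[mu]_(r in shell k) (f r)%:E)%E.
Proof.
rewrite -bigcup_dyadic_shells; apply: ge0_integral_bigcup => //=.
- by move=> k; exact: measurable_itv.
- by apply: measurable_f; apply: bigcup_measurable => k _; exact: measurable_itv.
- by move=> r [k _ /shell_ge0 r0]; rewrite lee_fin f_ge0.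
- exact: trivIset_dyadic_shells.
Qed.

Let shell_cst k (c : R) : (\int[mu]_(r in shell k) c%:E = (c * 2 ^+ k)%:E)%E.
Proof.
rewrite /shell integral_cst//= lebesgue_measure_itv/= lte_fin ltr_eXn2l ?ltr1n// ltnSn.
by rewrite -EFinB -EFinM exprS; congr (_ * _)%:E; ring.
Qed.

(** On a shell the volume lies between its values at the two end radii; this
gives the upper bound here and the lower bound below, with consecutive terms of
the dyadic series. *)
Let integral_shell_le k :
  (\int[mu]_(r in shell k) (f r)%:E <= (2 * dyadic_term k)%:E)%E.
Proof.
have -> : 2 * dyadic_term k = 2 ^+ k.+1 * M (2 ^+ k) `^ (1 - q) * 2 ^+ k.
  by rewrite /dyadic_term (exprS 2 k); ring.
rewrite -shell_cst; apply: ge0_le_integral => //=.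
- exact: measurable_itv.
- by move=> r /shell_ge0 r0; rewrite lee_fin f_ge0.
- by apply: measurable_f; exact: measurable_itv.
move=> r; rewrite /shell/= in_itv/= => /andP[kr rk]; rewrite lee_fin /f -powRN opprB.
have k0 : 0 < 2 ^+ k :> R by exact: exprn_gt0.
apply: ler_pM; rewrite ?powR_ge0 ?(ltW rk)//; first exact: le_trans kr.
rewrite -(opprB q) !powRN lef_pV2 ?posrE ?powR_gt0 ?M_gt0 ?(ltW k0) ?(le_trans _ kr)//.
by rewrite ge0_ler_powR ?nnegrE ?subr_ge0 ?M_mono// ltW// M_gt0// ?(le_trans _ kr)// ltW.
Qed.

Let integral_shell_ge k :
  ((dyadic_term k.+1 / 4)%:E <= \int[mu]_(r in shell k) (f r)%:E)%E.
Proof.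
have -> : dyadic_term k.+1 / 4 = 2 ^+ k * M (2 ^+ k.+1) `^ (1 - q) * 2 ^+ k.
  by rewrite /dyadic_term (exprS 2 k); field.
rewrite -shell_cst; apply: ge0_le_integral => //=.
- exact: measurable_itv.
- by move=> r _; rewrite lee_fin mulr_ge0 ?powR_ge0// exprn_ge0.
- by apply: measurable_f; exact: measurable_itv.
move=> r; rewrite /shell/= in_itv/= => /andP[kr rk]; rewrite lee_fin /f -powRN opprB.
have k0 : 0 < 2 ^+ k :> R by exact: exprn_gt0.
have r0 : 0 < r by apply: lt_le_trans kr.
apply: ler_pM; rewrite ?powR_ge0 ?(ltW k0)//.
have k1 : 0 < 2 ^+ k.+1 :> R by exact: exprn_gt0.
rewrite -(opprB q) !powRN lef_pV2 ?posrE ?powR_gt0 ?M_gt0 ?(ltW k1) ?(ltW r0)//.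
by rewrite ge0_ler_powR ?nnegrE ?subr_ge0 ?M_mono ?(ltW rk) ?(ltW q1)// ltW// M_gt0// ltW.
Qed.

Lemma dyadic_sum_unbounded (K : R) :
  (\int[mu]_(r in `[1%R, +oo[) (r / M r `^ (q - 1))%:E = +oo)%E ->
  ~ (forall n, \sum_(0 <= j < n) dyadic_term j <= K).
Proof.
move=> infty bound; suff : ((+oo : \bar R) <= (2 * K)%:E)%E by [].
rewrite -infty [X in (X <= _)%E]integral_shellE; apply: lime_le.
  apply: is_cvg_nneseries => k _ _; apply: integral_ge0 => r /shell_ge0 r0.
  by rewrite lee_fin f_ge0.
apply: nearW => n; apply: (@le_trans _ _ (\sum_(0 <= k < n) (2 * dyadic_term k)%:E)%E).
  by apply: lee_sum => k _; exact: integral_shell_le.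
by rewrite sumEFin lee_fin -mulr_sumr ler_wpM2l.
Qed.

Lemma volume_integral_infinite :
  (forall K : R, ~ (forall n, \sum_(0 <= j < n) dyadic_term j <= K)) ->
  (\int[mu]_(r in `[1%R, +oo[) (r / M r `^ (q - 1))%:E = +oo)%E.
Proof.
move=> unbounded; apply: contrapT => fin.
have I0 : (0 <= \int[mu]_(r in `[1%R, +oo[) (f r)%:E)%E.
  apply: integral_ge0 => r /=; rewrite in_itv/= andbT => r1.
  by rewrite lee_fin f_ge0// (le_trans _ r1).
set I := (\int[mu]_(r in _) _)%E in fin.
have IE : (I = (fine I)%:E)%E.
  by rewrite fineK// ge0_fin_numE// ltey; apply/eqP.
apply: (unbounded (dyadic_term 0 + 4 * fine I)) => n.
have g0 j : 0 <= dyadic_term j by rewrite mulr_ge0 ?powR_ge0// sqr_ge0.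
apply: (@le_trans _ _ (\sum_(0 <= j < n.+1) dyadic_term j)).
  by rewrite big_nat_recr//= lerDl.
rewrite big_nat_recl//= lerD2l.
suff : \sum_(0 <= j < n) dyadic_term j.+1 / 4 <= fine I.
  by rewrite -mulr_suml; lra.
rewrite -lee_fin -IE /I [leRHS]integral_shellE -sumEFin.
apply: le_trans (nneseries_lim_ge n _); last first.
  move=> k _ _; apply: integral_ge0 => r /shell_ge0 r0.
  by rewrite lee_fin f_ge0.
by apply: lee_sum => k _; exact: integral_shell_ge.
Qed.

End VolumeIntegral.

(** * The Liouville theorem *)

(** A connected graph with more than one vertex has no isolated vertex. *)
Lemma vertex_nu_gt0 {R : realType} {V : choiceType} (e : rel V) (mu : V -> V -> R)
    (sigma : V -> R) : infinite_set [set: V] -> locally_finite_graph e ->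
  connected_graph e -> edge_weight e mu -> (forall x, 0 < sigma x) ->
  forall x, 0 < vertex_nu e mu sigma x.
Proof.
move=> Vinf lf conn [mu_sym mu_gt0 mu_eq0] sigma_gt0 x; apply: mulr_gt0 => //.
have [y yx] : exists y, y != x.
  apply: contrapT => H; apply: Vinf; suff -> : [set: V] = [set x] by exact: finite_set1.
  apply/seteqP; split => // y _; apply: contrapT => yx; apply: H.
  by exists y; apply/eqP.
have [[|z p] /=] := conn x y; first by move=> _ xy; rewrite -xy eqxx in yx.
move=> /andP[xz _] _; rewrite /vertex_mu fsbig_finite; last exact: lf.
have zN : z \in enum_fset (fset_set (neighbors e x)).
  by rewrite in_fset_set ?inE//; exact: lf.
rewrite (big_rem z zN)/= ltr_pwDl ?mu_gt0//; apply: sumr_ge0 => w _.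
by have [/mu_gt0/ltW//|/mu_eq0->] := boolP (e x w).
Qed.

Lemma ball_volume_mono {R : realType} {V : choiceType} (e : rel V)
    (mu : V -> V -> R) (sigma : V -> R) (rho : V -> V -> R) (o : V) :
  proper_dist e rho -> (forall x, 0 < vertex_nu e mu sigma x) ->
  {homo ball_volume e mu sigma rho o : r s / r <= s}.
Proof.
by move=> proper nu0 r s rs; apply: ball_volume_subset => // x /le_trans; apply.
Qed.

(** At scales beyond the distance of the centres, the ball of radius 2^j around
o' lies in the ball of radius 2^(j+1) around o, so the dyadic series of o is
dominated, up to a shift of the index, by four times that of o'. *)
Lemma volume_integral_diverges_center {R : realType} {V : choiceType} (e : rel V)
    (mu : V -> V -> R) (sigma : V -> R) (rho : V -> V -> R) (q : R) (o o' : V) :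
  1 < q -> connected_graph e -> edge_length e rho -> proper_dist e rho ->
  (forall x, 0 < vertex_nu e mu sigma x) ->
  volume_integral_diverges e mu sigma rho q o ->
  volume_integral_diverges e mu sigma rho q o'.
Proof.
move=> q1 conn hrho proper nu0 div_o.
have mono w := @ball_volume_mono _ _ _ _ sigma rho w proper nu0.
have pos w r := @ball_volume_gt0 _ _ _ _ _ _ conn hrho proper nu0 w r.
apply: (volume_integral_infinite q1 (mono o') (pos o')) => K bound.
set g' := dyadic_term q _ in bound.
pose g := dyadic_term q (ball_volume e mu sigma rho o).
have g0 j : 0 <= g j by rewrite mulr_ge0 ?powR_ge0// sqr_ge0.
have g'0 j : 0 <= g' j by rewrite mulr_ge0 ?powR_ge0// sqr_ge0.
pose k0 := Num.bound (path_dist e rho o o').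
have dk0 : path_dist e rho o o' < 2 ^+ k0.
  apply: (@lt_trans _ _ k0%:R); first by apply: archi_boundP; exact: path_dist_ge0.
  by rewrite -natrX ltr_nat ltn_expl.
have shift j : (k0 <= j)%N -> g j.+1 <= 4 * g' j.
  move=> kj; rewrite /g /g' /dyadic_term (exprS 2 j).
  have j0 : 0 < 2 ^+ j :> R by exact: exprn_gt0.
  have vol : ball_volume e mu sigma rho o' (2 ^+ j) <=
      ball_volume e mu sigma rho o (2 * 2 ^+ j).
    apply: ball_volume_subset => // x o'x.
    apply: le_trans (path_dist_triangle conn hrho o o' x) _.
    have : 2 ^+ k0 <= 2 ^+ j :> R by rewrite ler_weXn2l// ler1n.
    by move=> ?; lra.
  rewrite exprMn (_ : 2 ^+ 2 = 4); last by ring.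
  rewrite -mulrA !ler_wpM2l ?sqr_ge0//.
  rewrite -(opprB q) !powRN lef_pV2 ?posrE ?powR_gt0 ?pos ?mulr_ge0 ?(ltW j0)//.
  by rewrite ge0_ler_powR ?nnegrE ?subr_ge0 ?(ltW q1)// ltW// pos// ?mulr_ge0 ltW.
apply: (dyadic_sum_unbounded q1 (mono o) (pos o) div_o (K := _ + 4 * K)).
apply: (@sum_nat_le_shifted _ g _ k0) => // n.
apply: (@le_trans _ _ (4 * \sum_(k0 <= j < k0 + n) g' j)).
  by rewrite mulr_sumr; apply: ler_sum_nat => j /andP[kj _]; exact: shift.
rewrite ler_wpM2l//; apply: le_trans (bound (k0 + n)%N).
exact: sum_nat_tail_le.
Qed.

Theorem theorem1p5 (R : realType) (V : choiceType) (e : rel V)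
    (mu : V -> V -> R) (sigma : V -> R) (rho : V -> V -> R) (q : R)
    (hq : 1 < q)
    (V_infinite : infinite_set [set: V])
    (e_sym : symmetric e) (e_irr : irreflexive e)
    (e_locfin : locally_finite_graph e) (e_conn : connected_graph e)
    (hmu : edge_weight e mu)
    (hsigma : forall x, 0 < sigma x)
    (hrho : edge_length e rho)
    (rho_adapted : adapted e mu sigma rho)
    (rho_proper : proper_dist e rho)
    (hvol : exists o : V, volume_integral_diverges e mu sigma rho q o) :
  (forall o : V, volume_integral_diverges e mu sigma rho q o) /\
  (forall u : R -> V -> R, classical_supersolution e mu sigma q u ->
     forall (t : R) (x : V), 0 < t -> u t x = 0).
Proof.
have nu0 := vertex_nu_gt0 V_infinite e_locfin e_conn hmu hsigma.
case: hvol => o div_o.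
split=> [w|u hu t x t0]; first exact: volume_integral_diverges_center div_o.
have [u0 _ _] := hu; apply/eqP; apply: contraT => utx_neq0.
have utx : 0 < u t x by rewrite lt_neqAle eq_sym utx_neq0 u0.
pose tau := Num.min (t / 2) 1.
have tau01 : 0 < tau <= 1 by rewrite lt_min divr_gt0//= ltr01/= ge_min lexx orbT.
have taut : tau < t by rewrite gt_min ltr_pdivrMr// ltr_pMr// ltr1n.
pose m := (Num.bound (young_exponent q)).+1.
have [b0 bq] := growth_exponent_bounds hq.
have hm : young_exponent q <= m%:R.
  have : young_exponent q < (Num.bound (young_exponent q))%:R.
    apply: archi_boundP; apply: divr_ge0; first exact: ltW.
    by rewrite subr_ge0 ltW.
  by move=> /ltW/le_trans; apply; rewrite ler_nat.
have [K bound] := dyadic_sum_bounded e_sym e_locfin e_conn hmu hrho rho_adapted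
  rho_proper nu0 (m := m) o hq isT hm hu tau01 taut utx.
exfalso; apply: (dyadic_sum_unbounded hq _ _ div_o bound).
- exact: ball_volume_mono.
- by move=> r; exact: ball_volume_gt0.
Qed.
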